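(* For all $m\ge 1$ and $x,y\in\mathbb{W}_N$, $$\mathbf{Pr}\big[\vec{G}(m)=y \,\big|\, \vec{G}(0)=x\big]=\det\big(M(i,j\,|\,x,y)\big)_{1\le i,j\le N},$$ where $$M(i,j\,|\,x,y)=\frac{1}{2\pi \mathrm{i}}\oint_{|z|=R}\frac{dz}{z}\,\frac{(zb_j)^{y_j}}{(zb_i)^{x_i}}\,\frac{\prod_{k=1}^{j}(z-1/b_k)}{\prod_{k=1}^{i}(z-1/b_k)}\,\prod_{k=1}^{m}\frac{1-a_kb_j}{1-a_k/z},$$ the radius satisfies $R>\max\{1/b_1,\dots,1/b_N\}$ and the circle is oriented counter-clockwise.
   Context: Parameters $a_i,b_j\in[0,1]$ ($i,j\ge1$) satisfy $0<a_ib_j<1$ for all $i,j$. The weights $\omega(i,j)$ are independent geometric random variables with $\mathbf{Pr}[\omega(i,j)=k]=(1-a_ib_j)(a_ib_j)^k$, $k=0,1,2,\dots$. Fix $N\ge1$ and let $\mathbb{W}_N=\{z\in\mathbb{Z}^N: z_1\le z_2\le\cdots\le z_N\}$. For $x\in\mathbb{W}_N$, the growth function started from $x$ is given by $G(0,n)=x_n$ for $1\le n\le N$, $G(m,0)=-\infty$ for $m\ge 1$, and $$G(m,n)=\max\{G(m-1,n),G(m,n-1)\}+\omega(m,n),\qquad m\ge1,\ 1\le n\le N.$$ Put $\vec{G}(m)=(G(m,1),\dots,G(m,N))$, a Markov chain on $\mathbb{W}_N$. $\mathbf{Pr}[\,\cdot\,|\,\vec{G}(0)=x]$ is the law of the process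 started from $x$. In the contour integral $\mathrm{i}=\sqrt{-1}$, while $i,j$ are matrix indices. *)

(* Defs.v *)
From HB Require Import structures.
From mathcomp Require Import all_boot all_order all_algebra finmap.
From mathcomp Require Import all_classical all_reals all_analysis.
From mathcomp Require Import complex.

Set Implicit Arguments.
Unset Strict Implicit.
Unset Printing Implicit Defensive.

Import Order.TTheory GRing.Theory Num.Theory.
Import numFieldNormedType.Exports.

Local Open Scope classical_set_scope.
Local Open Scope ring_scope.
Local Open Scope complex_scope.

Definition mutually_independent d (T : measurableType d) (R : realType)
    (P : probability T R) d' (E : measurableType d') (I : choiceType)
    (D : set I) (X : I -> {RV P >-> E}) : Prop :=
  forall (A : {fset I}) (B : I -> set E),
    [set` A] `<=` D ->
    (forall i, i \in A -> measurable (B i)) ->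
    P (\bigcap_(i in [set` A]) (X i @^-1` B i)) =
    (\prod_(i <- A) fine (P (X i @^-1` B i)))%:E.

Definition is_geometric d (T : measurableType d) (R : realType)
    (P : probability T R) (q : R) (X : {RV P >-> nat}) : Prop :=
  forall k : nat, P (X @^-1` [set k]) = ((1 - q) * q ^+ k)%:E.

Definition weyl_chamber (N : nat) : {pred N.-tuple int} :=
  [pred z : N.-tuple int | sorted <=%R (z : seq int)].

(* Components of a vector are numbered from 1, i.e. z = (z_1, ..., z_N); the
   default value at other indices is never used. *)
Definition component (N : nat) (z : N.-tuple int) (n : nat) : int :=
  nth 0 z n.-1.

(* The value at (0, 0) is a placeholder: it is used by no G(m, n) with n >= 1. *)
Fixpoint growth (N : nat) (x : N.-tuple int) (w : nat -> nat -> nat)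
    (m : nat) {struct m} : nat -> \bar int :=
  if m is m'.+1 then
    fix growth_row (n : nat) : \bar int :=
      if n is n'.+1 then
        (Order.max (growth x w m' n'.+1) (growth_row n')
          + (Posz (w m'.+1 n'.+1))%:E)%E
      else -oo%E
  else fun n => if n is n'.+1 then (component x n'.+1)%:E else -oo%E.

Definition growth_vector (N : nat) (x : N.-tuple int) (w : nat -> nat -> nat)
    (m : nat) : N.-tuple (\bar int) :=
  [tuple growth x w m i.+1 | i < N].

Definition complex_integral (R : realType) (D : set R) (f : R -> R[i]) : R[i] :=
  (\int[@lebesgue_measure R]_(t in D) complex.Re (f t))
    +i* (\int[@lebesgue_measure R]_(t in D) complex.Im (f t)).

(* The circle |z| = r is parametrised counter-clockwise by gamma(t) = r e^{it},
   0 <= t <= 2 pi, so that gamma'(t) = i gamma(t). *)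
Definition circle_integral (R : realType) (r : R) (f : R[i] -> R[i]) : R[i] :=
  let gamma (t : R) : R[i] := (r * cos t) +i* (r * sin t) in
  complex_integral `[0, 2 * pi] (fun t => f (gamma t) * ('i%C * gamma t)).

Definition kernelM (R : realType) (a b : nat -> R) (N : nat) (m : nat) (r : R)
    (x y : N.-tuple int) (i j : nat) : R[i] :=
  (2 * pi%:C * 'i%C)^-1 *
  circle_integral r (fun z : R[i] =>
    z^-1
    * ((z * (b j)%:C) ^ component y j / (z * (b i)%:C) ^ component x i)
    * ((\prod_(1 <= k < j.+1) (z - (b k)%:C^-1))
       / \prod_(1 <= k < i.+1) (z - (b k)%:C^-1))
    * \prod_(1 <= k < m.+1) ((1 - (a k * b j)%:C) / (1 - (a k)%:C / z))).

Arguments weyl_chamber {N}.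

(* Main.v *)
Require Import Defs.
From HB Require Import structures.
From mathcomp Require Import all_boot all_order all_algebra finmap.
From mathcomp Require Import all_classical all_reals all_analysis.
From mathcomp Require Import complex.
From mathcomp Require Import zify ring lra.

Set Implicit Arguments.
Unset Strict Implicit.
Unset Printing Implicit Defensive.

Import Order.TTheory GRing.Theory Num.Theory.
Import numFieldNormedType.Exports.
Import ComplexField.Normc.

Local Open Scope classical_set_scope.
Local Open Scope ring_scope.
Local Open Scope complex_scope.

(** Write the contour integral as M(i, j | x, y) = C b_j^(y_j) psi_j(y_j), where
    psi_j(p) (row i and time m understood) is the mean over the circle of z^p
    times a rational function with poles inside the circle, and C is the
    product of the 1 - a_k b_j.  The functions psi obey two recurrences: one
    more column multiplies the integrand by z - 1/b, so that
    psi_(j+1)(p) = psi_j(p+1) - psi_j(p) / b_(j+1) ([moment_col]), and one more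
    row divides it by 1 - a/z ([moment_row]).  Since |psi(p)| is at most a
    constant times r^p, with r above the modulus of every pole, psi vanishes near
    -oo as soon as the source term of its recurrence does ([decay_eq0]).
    Hence all sums over positions below are finite.

    Given G(m-1) = p, the probability that G(m) = q is the product over j of
    the geometric law at q_j - max(p_j, q_(j-1)), so that the law at time m is
    the sum over p in the Weyl chamber of the law at time m-1 times this product
    ([growth_law_step]).  The determinant satisfies the same recursion
    ([sum_det_step]), for two reasons.

    First, the sum may be extended to all p in Z^N ([sum_det_ascending]).  If
    the first descent of p is p_(j+1) < p_j, the weight does not depend on
    p_(j+1), because p_(j+1) < p_j <= q_j; and the sum over p_(j+1) < p_j of
    column j+1 telescopes to a multiple of column j at p_j, so that the
    determinant vanishes.

    Secondly, the unrestricted sum is taken column by column.  If the growth in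
    column j always started from p_j, the sum would be the geometric convolution
    that turns time m-1 into time m.  Starting from max(p_j, q_(j-1)) instead
    adds a multiple of column j-1 at time m, evaluated at q_(j-1)
    ([sum_entry_step]), and adding multiples of the previous columns does not
    change the determinant.

    At time 0 the entries on one side of the diagonal vanish for y_j <= x_i and
    those on the other side for y_j > x_i, which makes the determinant equal
    to 1 if x = y and to 0 otherwise ([det_delta]). *)

(** * Determinants summed over column positions *)

Section Determinants.
Variable F : numFieldType.

Definition ffun_update (I : finType) (T : Type) (f : {ffun I -> T}) (j : I) (k : T) :=
  [ffun i => if i == j then k else f i].

(** Exchanging the value f j with a proposed value k is an involution of the
    pairs (f, k), so the sum of G over all updates counts each G f exactly #|J|
    times. *)
Lemma sum_update_eq0 (I J : finType) (j : I) (G : {ffun I -> J} -> F) :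
  (forall f, \sum_k G (ffun_update f j k) = 0) -> \sum_f G f = 0.
Proof.
move=> G0; have [J0|J1] := posnP #|J|.
  apply: big1 => f _; have := card0_eq J0 (f j); by rewrite inE.
pose h (u : {ffun I -> J} * J) := (ffun_update u.1 j u.2, u.1 j).
have hK : involutive h.
  move=> [f k]; rewrite /h /= /ffun_update !ffunE eqxx; congr pair.
  by apply/ffunP => i; rewrite !ffunE; case: eqP => [->|].
have : \sum_(u : {ffun I -> J} * J) G (h u).1 = 0.
  by rewrite -(pair_bigA _ (fun f k => G (ffun_update f j k))) /= big1.
rewrite -(reindex_inj (P := xpredT) (F := fun u => G u.1) (inv_inj hK)) /=.
rewrite -(pair_bigA _ (fun f k => G f)) /=.
under eq_bigr do rewrite sumr_const -mulr_natr.
rewrite -mulr_suml => /eqP; rewrite mulf_eq0 => /orP [/eqP //|].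
by rewrite pnatr_eq0 -[#|predT|]/#|J|; move: J1; case: #|J|.
Qed.

Lemma det_col_eq0 n (A B : 'M[F]_n) (j0 j : 'I_n) (c : F) : j0 != j ->
  (forall i l, l != j -> A i l = B i l) -> (forall i, A i j = c * B i j0) ->
  \det A = 0.
Proof.
move=> ne AB Aj; rewrite -det_tr.
have AE i : A^T j i = c * A^T j0 i + 0 * A^T j0 i.
  by rewrite !mxE Aj AB // mul0r addr0.
rewrite (determinant_multilinear (B := \matrix_(k, i) A^T (if k == j then j0 else k) i)
  (C := \matrix_(k, i) A^T (if k == j then j0 else k) i) (b := c) (c := 0) (i0 := j)).
- rewrite mul0r addr0 (determinant_alternate ne) ?mulr0 // => i.
  by rewrite !mxE eqxx (negbTE ne).
- by apply/rowP => i; rewrite mxE AE !mxE eqxx.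
- by apply/matrixP => k i; rewrite !mxE eq_sym (negbTE (neq_lift _ _)).
- by apply/matrixP => k i; rewrite !mxE eq_sym (negbTE (neq_lift _ _)).
Qed.

(** Multilinearity in the columns, all the position sums being performed at
    once. *)
Lemma sum_det_cols n K (u : 'I_n -> 'I_n -> 'I_K -> F) (W : 'I_n -> 'I_K -> F) :
  \sum_(f : {ffun 'I_n -> 'I_K})
     \det (\matrix_(i, j) u i j (f j)) * \prod_j W j (f j) =
  \det (\matrix_(i, j) \sum_k u i j k * W j k).
Proof.
under eq_bigr => f _ do rewrite -det_tr /determinant mulr_suml.
rewrite exchange_big /= -det_tr /determinant; apply: eq_bigr => s _.
under eq_bigr => f _ do rewrite -mulrA -big_split /=.
rewrite -mulr_sumr; congr (_ * _).
under [RHS]eq_bigr => j _ do rewrite !mxE.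
rewrite bigA_distr_bigA /=; apply: eq_bigr => f _.
by apply: eq_bigr => j _; rewrite !mxE.
Qed.

Definition ascending_upto n K (t : nat) (f : {ffun 'I_n -> 'I_K}) :=
  [forall i : 'I_n, forall j : 'I_n, (j == i.+1 :> nat) && (j <= t)%N ==> (f i <= f j)%N].

(** The functions whose first descent is from column i to column j = i + 1
    contribute nothing: with the other positions fixed, the sum over the
    position of column j below that of column i makes column j proportional to
    column i, by hypothesis.  The induction on [t] removes one possible place of
    the first descent at a time. *)
Lemma sum_det_ascending n K (u : 'I_n -> 'I_n -> 'I_K -> F) (W : 'I_n -> 'I_K -> F) :
  (forall (i j : 'I_n) (k : 'I_K), j = i.+1 :> nat ->
     exists c, forall row,
      W i k * (\sum_(l < K | (l < k)%N) u row j l * W j l) = c * u row i k) ->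
  \sum_(f : {ffun 'I_n -> 'I_K} | ascending_upto n f)
     \det (\matrix_(i, j) u i j (f j)) * \prod_j W j (f j) =
  \det (\matrix_(i, j) \sum_k u i j k * W j k).
Proof.
move=> desc; rewrite -sum_det_cols.
pose G (f : {ffun 'I_n -> 'I_K}) := \det (\matrix_(i, j) u i j (f j)) * \prod_j W j (f j).
suff H t : \sum_(f : {ffun 'I_n -> 'I_K} | ascending_upto t f) G f
   = \sum_f G f by exact: H.
elim: t => [|t <-].
  apply: eq_bigl => f; apply/forallP => i; apply/forallP => j.
  by apply/implyP => /andP [/eqP -> ].
have [tn|nt] := ltnP t.+1 n; last first.
  apply: eq_bigl => f; apply/eq_forallb => i; apply/eq_forallb => j.
  case: eqP => //= _; congr (_ ==> _); apply/idP/idP => jt; have := ltn_ord j; lia.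
pose j := Ordinal tn; pose i := Ordinal (ltnW tn).
have ascS (f : {ffun 'I_n -> 'I_K}) : ascending_upto t.+1 f =
    ascending_upto t f && (f i <= f j)%N.
  apply/idP/andP => [/forallP H|[/forallP H le]].
    split; last by have /forallP /(_ j) := H i; rewrite eqxx leqnn.
    apply/forallP => i'; apply/forallP => j'; apply/implyP => /andP [e l].
    by have /forallP /(_ j') := H i'; rewrite e leqW.
  apply/forallP => i'; apply/forallP => j'; apply/implyP => /andP [e l].
  have [jt|jt] := leqP j' t.
    by have /forallP /(_ j') := H i'; rewrite e jt.
  have -> : j' = j by apply/val_inj => /=; lia.
  by have -> : i' = i by apply/val_inj => /=; move/eqP: e; lia.
rewrite [RHS](bigID (fun f : {ffun 'I_n -> 'I_K} => (f i <= f j)%N)) /=.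
under eq_bigl => f do rewrite ascS.
rewrite -[LHS]addr0; congr (_ + _); apply/esym.
rewrite big_mkcond /=; apply: (@sum_update_eq0 _ _ j) => f.
have ij : i != j by apply/eqP => /(congr1 val) /=; lia.
have updj k : ffun_update f j k j = k by rewrite ffunE eqxx.
have updN k l : l != j -> ffun_update f j k l = f l by rewrite ffunE => /negbTE ->.
have asc_upd k : ascending_upto t (ffun_update f j k)
   = ascending_upto t f.
  apply/eq_forallb => i'; apply/eq_forallb => j'.
  case: andP => //= -[/eqP e l]; rewrite !updN //.
    by apply/eqP => /(congr1 val) /=; lia.
  by apply/eqP => /(congr1 val) /=; lia.
have [asc|nasc] := boolP (ascending_upto t f); last first.
  by apply: big1 => k _; rewrite asc_upd (negbTE nasc).
have -> : \sum_k (if ascending_upto t (ffun_update f j k)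
    && ~~ (ffun_update f j k i <= ffun_update f j k j)%N then G (ffun_update f j k) else 0)
  = \sum_(k < K | (k < f i)%N) G (ffun_update f j k).
  rewrite [RHS]big_mkcond; apply: eq_bigr => k _.
  by rewrite asc_upd asc updj updN //= -ltnNge.
pose rest := \prod_(l | (l != i) && (l != j)) W l (f l).
have GE k : G (ffun_update f j k) =
  \det (\matrix_(r, l) if l == j then W i (f i) * (u r j k * W j k) else u r l (f l)) * rest.
  rewrite /G (bigD1 j) //= (bigD1 i) //= updj updN //.
  rewrite (eq_bigl (fun l => (l != i) && (l != j))); last by move=> l; rewrite andbC.
  have -> : \prod_(l | (l != i) && (l != j)) W l (ffun_update f j k l) = rest.
    by apply: eq_bigr => l /andP [_ lj]; rewrite updN.
  rewrite !mulrA; congr (_ * rest).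
  rewrite !(expand_det_col _ j) !mulr_suml; apply: eq_bigr => r _.
  rewrite !mxE updj eqxx -mulrA mulrC -!mulrA mulrCA [RHS]mulrC.
  have -> : cofactor (\matrix_(i0, j0) u i0 j0 (ffun_update f j k j0)) r j =
    cofactor (\matrix_(r0, l) if l == j then W i (f i) * (u r0 j k * W j k) else u r0 l (f l)) r j.
    congr (_ * \det _); apply/matrixP => p q; rewrite !mxE updN ?neq_lift //.
      by rewrite eq_sym (negbTE (neq_lift _ _)).
    by rewrite eq_sym neq_lift.
  by rewrite !mulrA; ring.
under eq_bigr => k _ do rewrite GE.
rewrite -mulr_suml (_ : \sum_(k < K | _) _ = 0) ?mul0r //.
have [c Hc] := desc i j (f i) erefl.
transitivity (\det (\matrix_(r, l) if l == j then W i (f i) *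
    (\sum_(k < K | (k < f i)%N) u r j k * W j k) else u r l (f l))).
  rewrite (expand_det_col _ j).
  under eq_bigr => k _ do rewrite (expand_det_col _ j).
  rewrite exchange_big /=; apply: eq_bigr => r _.
  rewrite !mxE eqxx mulr_sumr mulr_suml; apply: eq_bigr => k _.
  rewrite !mxE eqxx; congr (_ * (_ * \det _)).
  by apply/matrixP => p q; rewrite !mxE eq_sym (negbTE (neq_lift _ _)).
apply: (@det_col_eq0 _ _ (\matrix_(r, l) u r l (f l)) i j c) => //.
- by move=> r l /negbTE lj; rewrite !mxE lj.
- by move=> r; rewrite !mxE eqxx Hc.
Qed.

(** The matrix is the old one times a unitriangular bidiagonal matrix. *)
Lemma det_add_prev_col n (v : 'I_n -> nat -> F) (c : nat -> F) :
  \det (\matrix_(i < n, j < n) (v i j + (if val j is j'.+1 then c j' * v i j' else 0)))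
  = \det (\matrix_(i < n, j < n) v i j).
Proof.
pose U : 'M[F]_n := \matrix_(i, j) ((i == j)%:R + (i.+1 == j)%:R * c i).
have -> : (\matrix_(i < n, j < n) (v i j + (if val j is j'.+1 then c j' * v i j' else 0)))
   = (\matrix_(i < n, j < n) v i j) *m U.
  apply/matrixP => i j; rewrite !mxE.
  under eq_bigr => k _ do rewrite !mxE mulrDr.
  rewrite big_split /= (bigD1 j) //= eqxx mulr1 [X in _ + X + _]big1 ?addr0; last first.
    by move=> k /negbTE ->; rewrite mulr0.
  congr (_ + _); case: j => [[|j'] lt] /=.
    by rewrite big1 // => k _; rewrite mul0r mulr0.
  rewrite (bigD1 (Ordinal (ltnW lt))) //= eqxx mul1r mulrC big1 ?addr0 // => k kj.
  case: eqP => [[e]|]; rewrite ?(mul0r, mulr0) //.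
  by case/eqP: kj; apply/val_inj.
rewrite det_mulmx; suff -> : \det U = 1 by rewrite mulr1.
rewrite -det_tr det_trig; first rewrite big1 // => i _.
  by rewrite !mxE eqxx gtn_eqF ?mul0r ?addr0.
apply/is_trig_mxP => i j ij; rewrite !mxE.
have -> : (j == i) = false by apply/eqP => e; move: ij; rewrite e ltnn.
have -> : (j.+1 == i) = false by apply/eqP; lia.
by rewrite mul0r addr0.
Qed.

(** If x and y differ at their smallest entries, sortedness makes the first row
    or the first column vanish; if they agree there, the first column is the
    first unit vector and the same argument applies to the remaining minor. *)
Lemma det_delta n (x y : 'I_n -> int) (A : 'M[F]_n) :
  (forall i j : 'I_n, (i <= j)%N -> x i <= x j) ->
  (forall i j : 'I_n, (i <= j)%N -> y i <= y j) ->
  (forall i, A i i = (x i == y i)%:R) ->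
  (forall i j : 'I_n, (j < i)%N -> y j <= x i -> A i j = 0) ->
  (forall i j : 'I_n, (i < j)%N -> x i < y j -> A i j = 0) ->
  \det A = [forall i, x i == y i]%:R.
Proof.
elim: n x y A => [|n IH] x y A xs ys Ad Al Au.
  by rewrite det_mx00; case: forallP => // -[] [].
have [lt|lt|e] := ltgtP (x ord0) (y ord0).
- have -> : [forall i, x i == y i] = false.
    by apply/forallP => /(_ ord0) /eqP e; rewrite e ltxx in lt.
  rewrite (expand_det_row _ ord0) big1 // => j _.
  have [->|j0] := eqVneq j ord0; first by rewrite Ad lt_eqF ?mul0r.
  rewrite Au ?mul0r ?(lt_le_trans lt) ?ys //.
  by rewrite lt0n.
- have -> : [forall i, x i == y i] = false.
    by apply/forallP => /(_ ord0) /eqP e; rewrite e ltxx in lt.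
  rewrite (expand_det_col _ ord0) big1 // => i _.
  have [->|i0] := eqVneq i ord0; first by rewrite Ad gt_eqF ?mul0r.
  rewrite Al ?mul0r ?(le_trans (ltW lt)) ?xs //.
  by rewrite lt0n.
- rewrite (expand_det_col _ ord0) big_ord_recl Ad e eqxx mul1r big1 ?addr0; last first.
    by move=> i _; rewrite Al ?mul0r // -e xs.
  rewrite /cofactor addn0 expr0 mul1r.
  rewrite (IH (fun i => x (lift ord0 i)) (fun i => y (lift ord0 i))).
  + congr (nat_of_bool _)%:R; apply/forallP/forallP => H i //.
    by case: (unliftP ord0 i) => [i' ->|->]; rewrite ?e.
  + by move=> i j ij; apply: xs; rewrite /= leq_add2l.
  + by move=> i j ij; apply: ys; rewrite /= leq_add2l.
  + by move=> i; rewrite !mxE Ad.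
  + by move=> i j ij le; rewrite !mxE; apply: Al.
  + by move=> i j ij le; rewrite !mxE; apply: Au.
Qed.

End Determinants.

(** * One row of growth, column by column *)

Section Steps.
Variable F : numFieldType.

Lemma exprz_addr1 (x : F) (n : int) : x != 0 -> x ^ (n + 1) = x ^ n * x.
Proof. by move=> x0; rewrite expfzDr // expr1z. Qed.

Definition step_weight (c : F) (s q : int) : F :=
  if s <= q then (1 - c) * c ^ (q - s) else 0.

(** The height from which column [n] (numbered from 0) starts to grow: [p] is its
    height before the new row, and [q] the heights after it. *)
Definition start_height (q : nat -> int) (n : nat) (p : int) : int :=
  if n is n'.+1 then Num.max p (q n') else p.

(** The window L, ..., L + K - 1 stands for all integers: the summands of interest
    vanish below it, and the test against [p] cuts them off above. *)
Lemma telescope_box (H : int -> F) (L : int) (K : nat) (p : int) :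
  L <= p <= L + K%:Z ->
  \sum_(k < K) (if L + k%:Z < p then H (L + k%:Z + 1) - H (L + k%:Z) else 0) =
  H p - H L.
Proof.
elim: K p => [|K IH] p /andP [Lp pK].
  by rewrite big_ord0 (_ : p = L) ?subrr //; lia.
rewrite big_ord_recr /=; case: ltrP => pL.
  have -> : p = L + K%:Z + 1 by lia.
  have -> : \sum_(k < K) (if L + k%:Z < L + K%:Z + 1 then H (L + k%:Z + 1) - H (L + k%:Z) else 0)
    = H (L + K%:Z) - H L.
    rewrite -(IH (L + K%:Z)); last by lia.
    apply: eq_bigr => k _; have := ltn_ord k => kK.
    by rewrite !ifT //; lia.
  by ring.
by rewrite addr0 IH //; lia.
Qed.

(** The solution of w p = c w (p - 1) + v p that vanishes to the left of the
    window is the convolution of v with the powers of c; each term of that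
    convolution is a difference of consecutive values of c^(q + 1 - p) w (p - 1). *)
Lemma geometric_box (c : F) (v w : int -> F) (L : int) (K : nat) (q : int) :
  c != 0 -> (forall p, w p = c * w (p - 1) + v p) -> w (L - 1) = 0 ->
  L <= q + 1 -> q < L + K%:Z ->
  \sum_(k < K) (if L + k%:Z <= q then c ^ (q - (L + k%:Z)) * v (L + k%:Z) else 0)
  = w q.
Proof.
move=> c0 vw wL Lq qK; pose H p := c ^ (q + 1 - p) * w (p - 1).
have HE : H (q + 1) - H L = w q.
  by rewrite /H subrr expr0z wL mulr0 subr0 mul1r addrK.
rewrite -HE -(@telescope_box _ _ K); last by lia.
apply: eq_bigr => k _; rewrite ltzD1 /H; case: ifP => // _.
have -> : q + 1 - (L + k%:Z + 1) = q - (L + k%:Z) by ring.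
have -> : q + 1 - (L + k%:Z) = q - (L + k%:Z) + 1 by ring.
rewrite addrK [w (L + k%:Z)]vw.
by rewrite exprz_addr1 //; ring.
Qed.

(* Psi i m j p stands for the contour integral, in row i, with the power z^p, the
   first j factors z - 1/b_k in the numerator and the first m factors 1 - a_k/z in
   the denominator.  Only its recurrences and its vanishing near -oo matter. *)
Variables (I : Type) (a b : nat -> F) (Psi : I -> nat -> nat -> int -> F).
Variables (N : nat) (L : int).
Hypothesis b0 : forall j, (1 <= j)%N -> b j != 0.
Hypothesis a0 : forall j, (1 <= j)%N -> a j != 0.
Hypothesis ab1 : forall i j, (1 <= i)%N -> (1 <= j)%N -> 1 - a i * b j != 0.
Hypothesis Psi_col : forall i m j p,
  Psi i m j.+1 p = Psi i m j (p + 1) - (b j.+1)^-1 * Psi i m j p.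
Hypothesis Psi_row : forall i m j p,
  Psi i m.+1 j p = a m.+1 * Psi i m.+1 j (p - 1) + Psi i m j p.
Hypothesis Psi_eq0 : forall i m j p, (j <= N)%N -> p <= L -> Psi i m j p = 0.

(** The kernel entry at time [m] in the column numbered [j] from 0, as a function of
    the position [p]; the products in its definition run over k = 1, ..., as the
    parameters do. *)
Definition kernel_entry i m j (p : int) : F :=
  \prod_(1 <= k < m.+1) (1 - a k * b j.+1) * b j.+1 ^ p * Psi i m j.+1 p.

(** The ratio of the normalisations of columns j + 1 and j at position [P]. *)
Definition prev_col_coef m j P : F :=
  \prod_(1 <= k < m.+1) (1 - a k * b j.+2) / \prod_(1 <= k < m.+1) (1 - a k * b j.+1)
  * b j.+2 ^ P / b j.+1 ^ P.

Lemma prod_ab_neq0 m j : \prod_(1 <= k < m.+1) (1 - a k * b j.+1) != 0.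
Proof.
rewrite prodf_seq_neq0; apply/allP => k; rewrite mem_index_iota => /andP [k1 _] /=.
exact: ab1.
Qed.

Lemma prev_col_coefE i m j P :
  \prod_(1 <= k < m.+1) (1 - a k * b j.+2) * b j.+2 ^ P * Psi i m j.+1 P
  = prev_col_coef m j P * kernel_entry i m j P.
Proof.
have h1 := prod_ab_neq0 m j.
have h2 : b j.+1 ^ P != 0 by rewrite expfz_neq0 ?b0.
rewrite /prev_col_coef /kernel_entry; move: h1 h2; set A := \prod_(_ <= k < _) _; set B := b j.+1 ^ P.
by set A' := \prod_(_ <= k < _) _; set B' := b j.+2 ^ P => h1 h2; field; rewrite h1 h2.
Qed.

(** By [Psi_col], b^p Psi_(j+1)(p) is the difference of the values of
    b^(p-1) Psi_j(p) at p + 1 and p: summing over positions cancels the last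
    factor z - 1/b. *)
Lemma sum_entry_lt i m j K P : (j < N)%N -> L <= P <= L + K%:Z ->
  \sum_(k < K) (if L + k%:Z < P then kernel_entry i m j (L + k%:Z) else 0) =
  \prod_(1 <= k < m.+1) (1 - a k * b j.+1) * b j.+1 ^ (P - 1) * Psi i m j P.
Proof.
move=> jN LP; have bj := b0 (ltn0Sn j).
pose H p := \prod_(1 <= k < m.+1) (1 - a k * b j.+1) * b j.+1 ^ (p - 1) * Psi i m j p.
have HL : H L = 0 by rewrite /H Psi_eq0 ?mulr0 // ltnW.
rewrite -/(H P) -[RHS]subr0 -[X in _ = _ - X]HL -(telescope_box _ LP).
apply: eq_bigr => k _.
case: ifP => // _; rewrite /H /kernel_entry Psi_col addrK.
move: (L + k%:Z) => p; set A := \prod_(_ <= _ < _) _.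
have -> : b j.+1 ^ p = b j.+1 ^ (p - 1) * b j.+1 by rewrite -exprz_addr1 // subrK.
by set B := _ ^ (p - 1); field.
Qed.

Lemma kernel_entryS i m j p :
  kernel_entry i m.+1 j p = a m.+1 * b j.+1 * kernel_entry i m.+1 j (p - 1)
    + (1 - a m.+1 * b j.+1) * kernel_entry i m j p.
Proof.
have bj := b0 (ltn0Sn j).
rewrite /kernel_entry Psi_row (big_nat_recr m.+1) //=.
have -> : b j.+1 ^ p = b j.+1 ^ (p - 1) * b j.+1 by rewrite -exprz_addr1 // subrK.
set A := \prod_(_ <= _ < _) _; set B := _ ^ _.
by ring.
Qed.

(** Dividing the integrand by 1 - a/z is the convolution with a geometric law. *)
Lemma sum_entry_le i m j K q : (j < N)%N -> L <= q + 1 -> q < L + K%:Z ->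
  \sum_(k < K) (if L + k%:Z <= q then kernel_entry i m j (L + k%:Z) *
    ((1 - a m.+1 * b j.+1) * (a m.+1 * b j.+1) ^ (q - (L + k%:Z))) else 0)
  = kernel_entry i m.+1 j q.
Proof.
move=> jN Lq qK.
rewrite -(@geometric_box (a m.+1 * b j.+1) (fun p => (1 - a m.+1 * b j.+1) * kernel_entry i m j p)
  (kernel_entry i m.+1 j) L K q) //.
- by apply: eq_bigr => k _; case: ifP => // _; ring.
- by rewrite mulf_neq0 ?a0 ?b0.
- exact: kernel_entryS.
- by rewrite /kernel_entry Psi_eq0 ?mulr0 //; lia.
Qed.

(** Put P = q (j - 1) and compare with the convolution of [sum_entry_le].  Only the
    positions p <= P differ: they start from P.  The correction is
    c^(Q - P) times (1 - c) sum_(p <= P) Phi_j(p) minus the new Phi_j(P), and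
    both terms are known, by [sum_entry_lt] and [sum_entry_le].  In terms of
    contour integrals it comes from the identity
    z/(z - 1/b) - z/(z - a) = (1/b - a) z/((z - 1/b)(z - a)), whose right-hand
    side lacks the factor z - 1/b of column j: this is column j - 1. *)
Lemma sum_entry_step i m j K (q : nat -> int) : (j < N)%N ->
  (forall n, (n <= j)%N -> L <= q n < L + K%:Z) ->
  (forall n, (n.+1 <= j)%N -> q n <= q n.+1) ->
  \sum_(k < K) kernel_entry i m j (L + k%:Z) *
     step_weight (a m.+1 * b j.+1) (start_height q j (L + k%:Z)) (q j) =
  kernel_entry i m.+1 j (q j) +
    (if j is j'.+1 then
       (a m.+1 * b j.+1) ^ (q j - q j') * ((b j.+1)^-1 - a m.+1) * prev_col_coef m.+1 j' (q j')
       * kernel_entry i m.+1 j' (q j') else 0).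
Proof.
case: j => [|j] jN qL qs /=.
  have /andP [q1 q2] := qL 0%N (leqnn _).
  rewrite addr0 -(@sum_entry_le _ _ _ K) //; last by lia.
  by apply: eq_bigr => k _; rewrite /step_weight; case: ifP => // _; rewrite mulr0.
have /andP [Q1 Q2] := qL j.+1 (leqnn _); have /andP [P1 P2] := qL j (leqnSn _).
have PQ := qs j (leqnn _).
move: (q j) (q j.+1) P1 P2 Q1 Q2 PQ => P Q P1 P2 Q1 Q2 PQ {qL qs}.
have bj := b0 (ltn0Sn j.+1); have aj := a0 (ltn0Sn m).
set c := a m.+1 * b j.+2.
have c0 : c != 0 by rewrite mulf_neq0.
(* Above P both kinds of growth start from the position itself. *)
transitivity (\sum_(k < K) (if L + k%:Z <= Q then kernel_entry i m j.+1 (L + k%:Z) *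
    ((1 - c) * c ^ (Q - (L + k%:Z))) else 0) +
  c ^ (Q - P) * ((1 - c) * (\sum_(k < K) (if L + k%:Z < P + 1 then kernel_entry i m j.+1 (L + k%:Z) else 0))
   - \sum_(k < K) (if L + k%:Z <= P then kernel_entry i m j.+1 (L + k%:Z) *
    ((1 - c) * c ^ (P - (L + k%:Z))) else 0))).
  rewrite [(1 - c) * _]mulr_sumr -sumrB mulr_sumr -big_split /=; apply: eq_bigr => k _.
  rewrite ltzD1 /step_weight; case: (lerP (L + k%:Z) P) => h.
    rewrite PQ (le_trans h PQ).
    have -> : c ^ (Q - (L + k%:Z)) = c ^ (Q - P) * c ^ (P - (L + k%:Z)).
      by rewrite -expfzDr //; congr (c ^ _); ring.
    by set X := c ^ (Q - P); set Y := c ^ _; ring.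
  by rewrite mulr0 subrr mulr0 addr0; case: ifP => _; rewrite ?mulr0.
rewrite sum_entry_le ?sum_entry_lt ?sum_entry_le //; [|by lia..].
congr (_ + _); rewrite addrK -[RHS]mulrA -prev_col_coefE /kernel_entry.
have -> : Psi i m j.+1 (P + 1) = Psi i m.+1 j.+1 (P + 1) - a m.+1 * Psi i m.+1 j.+1 P.
  by rewrite (Psi_row _ _ _ (P + 1)) addrK; ring.
rewrite (Psi_col i m.+1 j.+1 P) (big_nat_recr m.+1) //=.
by set A := \prod_(_ <= _ < _) _; set B := b j.+2 ^ P; set X := c ^ _; rewrite /c; field.
Qed.

End Steps.

Section Transition.
Variable F : numFieldType.
Variables (N : nat) (a b : nat -> F) (Psi : 'I_N -> nat -> nat -> int -> F) (L : int).
Hypothesis b0 : forall j, (1 <= j)%N -> b j != 0.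
Hypothesis a0 : forall j, (1 <= j)%N -> a j != 0.
Hypothesis ab1 : forall i j, (1 <= i)%N -> (1 <= j)%N -> 1 - a i * b j != 0.
Hypothesis Psi_col : forall i m j p,
  Psi i m j.+1 p = Psi i m j (p + 1) - (b j.+1)^-1 * Psi i m j p.
Hypothesis Psi_row : forall i m j p,
  Psi i m.+1 j p = a m.+1 * Psi i m.+1 j (p - 1) + Psi i m j p.
Hypothesis Psi_eq0 : forall i m j p, (j <= N)%N -> p <= L -> Psi i m j p = 0.

(** At a descent from column j - 1 to column j the weight of column j does not
    depend on its position, which lies below that of column j - 1, itself at
    most q (j - 1) unless its weight vanishes.  By [sum_entry_lt] the sum over
    that position is then a multiple of column j - 1. *)
Lemma sum_det_step m K (q : nat -> int) :
  (forall n, (n < N)%N -> L <= q n < L + K%:Z) ->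
  (forall n, (n.+1 < N)%N -> q n <= q n.+1) ->
  \sum_(f : {ffun 'I_N -> 'I_K} | ascending_upto N f)
     \det (\matrix_(i < N, j < N) kernel_entry a b Psi i m j (L + (f j)%:Z)) *
     \prod_(j < N) step_weight (a m.+1 * b j.+1)
        (start_height q j (L + (f j)%:Z)) (q j) =
  \det (\matrix_(i < N, j < N) kernel_entry a b Psi i m.+1 j (q j)).
Proof.
move=> qL qs.
rewrite (@sum_det_ascending F N K (fun i j k => kernel_entry a b Psi i m j (L + k%:Z))
 (fun j k => step_weight (a m.+1 * b j.+1) (start_height q j (L + k%:Z)) (q j))).
- rewrite -[RHS](det_add_prev_col (fun i j => kernel_entry a b Psi i m.+1 j (q j))
    (fun j => (a m.+1 * b j.+2) ^ (q j.+1 - q j) *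
    ((b j.+2)^-1 - a m.+1) * prev_col_coef a b m.+1 j (q j))).
  congr (\det _); apply/matrixP => i j; rewrite !mxE.
  rewrite (@sum_entry_step _ _ _ _ _ N L) //.
  + by case: (j) => [[|j'] ?].
  + by move=> n nj; apply: qL; apply: leq_ltn_trans nj _.
  + by move=> n nj; apply: qs; apply: leq_ltn_trans nj _.
- move=> i j k ji.
  have [le|lt] := lerP (L + k%:Z) (q i); last first.
    exists 0 => r; rewrite /step_weight ifF ?mul0r //.
    apply/negbTE; rewrite -ltNge /start_height.
    by case: (nat_of_ord i) lt => [|i'] // lt; rewrite lt_max lt.
  exists (step_weight (a m.+1 * b i.+1) (start_height q i (L + k%:Z)) (q i) *
    (step_weight (a m.+1 * b j.+1) (q i) (q j) * (b j.+1)^-1 * prev_col_coef a b m i (L + k%:Z))) => r.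
  rewrite -[RHS]mulrA; congr (_ * _).
  transitivity (step_weight (a m.+1 * b j.+1) (q i) (q j) *
    \sum_(l < K) (if L + l%:Z < L + k%:Z then kernel_entry a b Psi r m j (L + l%:Z) else 0)).
    rewrite mulr_sumr big_mkcond; apply: eq_bigr => l _.
    rewrite ltrD2l ltz_nat; case: ltnP => lk; rewrite ?mulr0 //.
    rewrite mulrC ji /start_height; congr (step_weight _ _ _ * _).
    by apply/max_idPr; lia.
  rewrite (@sum_entry_lt _ _ a b Psi N L) //; last by have := ltn_ord k; lia.
  rewrite ji -[RHS]mulrA -prev_col_coefE //.
  by rewrite expfzDr ?b0 // exprN1; ring.
Qed.

End Transition.

(** * The law of the growth process *)

Section Growth.
Variables (N : nat) (x : N.-tuple int) (w : nat -> nat -> nat).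

(** The growth function with integer values and columns numbered from 0; the
    boundary value -oo disappears into [start_height]. *)
Fixpoint height (m : nat) : nat -> int :=
  if m is m'.+1 then
    fix height_row n :=
      (if n is n'.+1 then Num.max (height m' n) (height_row n') else height m' n)
      + (w m'.+1 n.+1)%:Z
  else nth 0 x.

Lemma heightS m n :
  height m.+1 n = start_height (height m.+1) n (height m n) + (w m.+1 n.+1)%:Z.
Proof. by case: n. Qed.

Lemma growthE m n : growth x w m n.+1 = (height m n)%:E.
Proof.
elim: m n => [|m IH] n //; elim: n => [|n IHn].
  have -> : growth x w m.+1 1 =
    (Order.max (growth x w m 1) -oo%E + (Posz (w m.+1 1))%:E)%E by [].
  by rewrite IH maxeNy.
have -> : growth x w m.+1 n.+2 =
  (Order.max (growth x w m n.+2) (growth x w m.+1 n.+1) + (Posz (w m.+1 n.+2))%:E)%E by [].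
by rewrite IH IHn -EFin_max.
Qed.

Lemma height_ge m n : nth 0 x n <= height m n.
Proof.
elim: m => // m IH; rewrite heightS; apply: le_trans IH _.
by rewrite /start_height; case: n => [|n]; lia.
Qed.

Lemma height_sorted m n : x \in weyl_chamber -> (n.+1 < N)%N ->
  height m n <= height m n.+1.
Proof.
move=> hx nN; case: m => [|m].
  by apply: (sorted_leq_nth le_trans lexx 0 hx); rewrite ?inE ?size_tuple // ltnW.
by rewrite [X in _ <= X]heightS /start_height; lia.
Qed.

Lemma growth_vectorP m (y : N.-tuple int) :
  growth_vector x w m = map_tuple EFin y <-> forall n, (n < N)%N -> height m n = nth 0 y n.
Proof.
split=> [e n nN|e].
  have := congr1 (fun z => tnth z (Ordinal nN)) e.
  by rewrite /growth_vector tnth_mktuple tnth_map growthE (tnth_nth 0) => -[].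
apply: eq_from_tnth => i; rewrite /growth_vector tnth_mktuple tnth_map growthE.
by rewrite e // (tnth_nth 0).
Qed.

End Growth.

Lemma start_height_eq (q q' : nat -> int) n p :
  (forall k, (k < n)%N -> q k = q' k) -> start_height q n p = start_height q' n p.
Proof. by case: n => //= n e; rewrite e. Qed.

(** Columns are determined from left to right, so the final heights may replace
    those computed so far in the maxima. *)
Lemma height_step N (x : N.-tuple int) (w : nat -> nat -> nat) m (q : nat -> int) :
  (forall n, (n < N)%N -> height x w m.+1 n = q n) <->
  (forall n, (n < N)%N -> start_height q n (height x w m n) + (w m.+1 n.+1)%:Z = q n).
Proof.
split=> e n nN.
  rewrite -[RHS]e // heightS; congr (_ + _); apply: start_height_eq => k kn.
  by rewrite e // (ltn_trans kn).
elim/ltn_ind: n nN => n IH nN; rewrite heightS -[RHS]e //; congr (_ + _).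
by apply: start_height_eq => k kn; apply: IH => //; apply: ltn_trans kn nN.
Qed.

(** Heights in a window of length [K] above [L]: a finite set of configurations
    that contains every one leading to a given final state. *)
Definition box_point (N K : nat) (L : int) (f : {ffun 'I_N -> 'I_K}) : N.-tuple int :=
  [tuple L + (f i)%:Z | i < N].

Lemma nth_box_point N K L (f : {ffun 'I_N -> 'I_K}) (i : 'I_N) :
  nth 0 (box_point L f) i = L + (f i)%:Z.
Proof. by rewrite -tnth_nth tnth_mktuple. Qed.

Lemma exists_box (s : seq int) :
  exists (L : int) (K : nat), forall z, z \in s -> L <= z < L + K%:Z.
Proof.
elim: s => [|u s [L [K LK]]]; first by exists 0, 0%N.
exists (Num.min L u), (absz (Num.max (L + K%:Z) (u + 1) - Num.min L u)%R) => z.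
rewrite inE => /orP [/eqP ->|/LK]; lia.
Qed.

Section Law.
Variables (R : realType) (a b : nat -> R) (d : measure_display) (T : measurableType d).
Variables (P : probability T R) (omega : nat * nat -> {RV P >-> nat}).
Hypothesis hgeom : forall i j : nat, (1 <= i)%N -> (1 <= j)%N ->
  is_geometric (a i * b j) (omega (i, j)).
Hypothesis hind : mutually_independent
      [set ij : nat * nat | (1 <= ij.1)%N /\ (1 <= ij.2)%N] omega.
Variables (N : nat) (x : N.-tuple int).

Definition geom (ij : nat * nat) (k : nat) : R :=
  (1 - a ij.1 * b ij.2) * (a ij.1 * b ij.2) ^+ k.

Definition weights_are (s : seq (nat * nat)) (v : nat * nat -> nat) : set T :=
  \bigcap_(ij in [set` s]) omega ij @^-1` [set v ij].

Definition growth_is (m : nat) (y : N.-tuple int) : set T :=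
  [set t : T | growth_vector x (fun i j => omega (i, j) t) m = map_tuple EFin y].

Lemma measurable_weights s v : measurable (weights_are s v).
Proof.
apply: fin_bigcap_measurable; first exact: finite_seq.
by move=> ij _; rewrite -[_ @^-1` _]setTI; apply: measurable_funP.
Qed.

Lemma weights_are_prob s v : uniq s ->
  (forall ij, ij \in s -> (1 <= ij.1)%N /\ (1 <= ij.2)%N) ->
  P (weights_are s v) = (\prod_(ij <- s) geom ij (v ij))%:E.
Proof.
move=> us hs.
rewrite /weights_are; have <- : [set` [fset ij in s]%fset] = [set` s].
  by apply/seteqP; split=> ij /=; rewrite !inE.
rewrite hind //=; last by move=> ij; rewrite /= !inE; exact: hs.
congr (_%:E); rewrite (perm_big s) /=; last first.
  by apply: uniq_perm; [exact: fset_uniq|by []|move=> ij; rewrite !inE].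
apply: eq_big_seq => -[i j] /hs [/= i1 j1].
by rewrite (hgeom i1 j1).
Qed.

(** Heights never decrease, so the state before the last row lies between x and q,
    hence in the box. *)
Lemma growth_is_step m (q : N.-tuple int) (L : int) (K : nat) :
  (forall n, (n < N)%N -> L <= nth 0 x n) ->
  (forall n, (n < N)%N -> nth 0 q n < L + K%:Z) ->
  growth_is m.+1 q = \bigcup_(f in [set` enum {ffun 'I_N -> 'I_K}])
    (growth_is m (box_point L f) `&`
     [set t | forall j : 'I_N, start_height (nth 0 q) j (L + (f j)%:Z)
         + (omega (m.+1, j.+1) t)%:Z = nth 0 q j]).
Proof.
move=> Lx qL; apply/seteqP; split=> t; last first.
  move=> [f _ [/growth_vectorP Gf /= e]]; apply/growth_vectorP/height_step => n nN.
  by rewrite Gf // -[n]/(nat_of_ord (Ordinal nN)) nth_box_point e.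
move=> /growth_vectorP G; have /height_step e := G.
pose h := height x (fun i j => omega (i, j) t) m.
have hL n : (n < N)%N -> L <= h n by move=> nN; apply: le_trans (Lx n nN) (height_ge _ _ _ _).
have hU n : (n < N)%N -> h n < L + K%:Z.
  move=> nN; apply: le_lt_trans (qL n nN); rewrite -(e n nN).
  by rewrite /h /start_height; case: n nN => [|n] nN; lia.
have hK (i : 'I_N) : (absz (h i - L)%R < K)%N.
  by have := hL i (ltn_ord i); have := hU i (ltn_ord i); lia.
pose f := [ffun i : 'I_N => Ordinal (hK i)].
have fE (i : 'I_N) : L + (f i)%:Z = h i.
  by rewrite ffunE /=; have := hL i (ltn_ord i); lia.
exists f; first by rewrite /= mem_enum.
split; first apply/growth_vectorP => n nN.
  by rewrite -[n]/(nat_of_ord (Ordinal nN)) nth_box_point fE.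
by move=> j; rewrite fE; exact: e.
Qed.

Lemma growth_is_inj m y y' t : growth_is m y t -> growth_is m y' t -> y = y'.
Proof.
move=> /growth_vectorP h /growth_vectorP h'.
apply: val_inj; apply: (@eq_from_nth _ 0); rewrite !size_tuple // => n nN.
by rewrite -h // h'.
Qed.

Definition row_cell m (q : N.-tuple int) L K (f : {ffun 'I_N -> 'I_K}) : set T :=
  growth_is m (box_point L f) `&`
  [set t | forall j : 'I_N, start_height (nth 0 q) j (L + (f j)%:Z)
         + (omega (m.+1, j.+1) t)%:Z = nth 0 q j].

Definition row_weight m (q : N.-tuple int) L K (f : {ffun 'I_N -> 'I_K}) : R :=
  \prod_(j < N) step_weight (a m.+1 * b j.+1)
    (start_height (nth 0 q) j (L + (f j)%:Z)) (nth 0 q j).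

Definition row_sites m := [seq (m.+1, (nat_of_ord j).+1) | j <- enum 'I_N].

(** The induction on the row reveals one more row of weights, so it must carry the
    independence from an arbitrary list of weights in later rows. *)
Definition growth_indep_at m := forall (y : N.-tuple int) s v, uniq s ->
  (forall ij, ij \in s -> (m < ij.1)%N /\ (1 <= ij.2)%N) ->
  measurable (growth_is m y) /\
  P (growth_is m y `&` weights_are s v) =
    (fine (P (growth_is m y)) * \prod_(ij <- s) geom ij (v ij))%:E.

Lemma weights_are_nil v : weights_are [::] v = setT.
Proof. by apply/seteqP; split. Qed.

(** Fixing the states before and after row m + 1 amounts to prescribing the
    weights of that row, which are appended to the list [s]. *)
Lemma row_cell_indep m q L K f s v : growth_indep_at m -> uniq s ->
  (forall ij, ij \in s -> (m.+1 < ij.1)%N /\ (1 <= ij.2)%N) ->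
  measurable (@row_cell m q L K f) /\
  P (row_cell m q L f `&` weights_are s v) =
    (fine (P (growth_is m (box_point L f))) * row_weight m q L f
      * \prod_(ij <- s) geom ij (v ij))%:E.
Proof.
move=> IH us hs.
have [|] := boolP [forall j : 'I_N,
    start_height (nth 0 q) j (L + (f j)%:Z) <= nth 0 q j]; last first.
  (* A column that would start above q makes both sides vanish. *)
  move=> /forallPn [j]; rewrite -ltNge => lt.
  have c0 : row_cell m q L f = set0.
    apply/seteqP; split=> // t [_ /= e]; by move: lt; rewrite -(e j) ltNge lerDl.
  have w0 : row_weight m q L f = 0.
    by rewrite /row_weight (bigD1 j) //= /step_weight leNgt lt mul0r.
  by rewrite c0 w0 set0I measure0 mulr0 mul0r; split => //; exact: measurable0.
move=> /forallP le.
(* Row m + 1 must supply exactly the missing increments; the other rows keep v. *)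
pose v' (ij : nat * nat) : nat := if ij.1 == m.+1 then
  absz (nth 0 q ij.2.-1 - start_height (nth 0 q) ij.2.-1 (nth 0 (box_point L f) ij.2.-1))%R
  else v ij.
have v'row (j : 'I_N) : (v' (m.+1, j.+1))%:Z =
    nth 0 q j - start_height (nth 0 q) j (L + (f j)%:Z).
  by rewrite /v' eqxx /= nth_box_point gez0_abs // subr_ge0.
have v's ij : ij \in s -> v' ij = v ij.
  by move=> /hs [lt _]; rewrite /v' gtn_eqF.
have usites : uniq (row_sites m).
  by rewrite map_inj_uniq ?enum_uniq // => i j [] /val_inj.
have cellE u : {subset u <= s} -> row_cell m q L f `&` weights_are u v =
    growth_is m (box_point L f) `&` weights_are (row_sites m ++ u) v'.
  move=> us'; rewrite /row_cell -setIA; congr (_ `&` _); apply/seteqP; split=> t.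
    move=> [e wt] ij /=; rewrite mem_cat => /orP [/mapP [j _ ->]|iju].
      by have := e j; have := v'row j; lia.
    by rewrite v's ?us' //; exact: wt.
  move=> wt; split=> [j|ij iju].
    have /= -> : omega (m.+1, j.+1) t = v' (m.+1, j.+1).
      by apply: wt; rewrite /= mem_cat map_f ?mem_enum.
    by rewrite v'row addrC subrK.
  by rewrite -v's ?us' //; apply: wt; rewrite /= mem_cat iju orbT.
have sites_later u : {subset u <= s} -> forall ij, ij \in row_sites m ++ u ->
    (m < ij.1)%N /\ (1 <= ij.2)%N.
  move=> us' ij; rewrite mem_cat => /orP [/mapP [j _ ->] //|/us' /hs [h1 h2]].
  by split => //; exact: ltnW.
have usites_s : uniq (row_sites m ++ s).
  rewrite cat_uniq usites us andbT /=; apply/hasPn => ij /hs [lt _].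
  by apply/negP => /mapP [j _ e]; rewrite e ltnn in lt.
split.
  have := cellE [::] (fun ij => _); rewrite weights_are_nil setIT cats0 => -> //.
  apply: measurableI; last exact: measurable_weights.
  by have [] := IH (box_point L f) [::] v isT (fun ij => _).
rewrite cellE //.
have [_ ->] := IH (box_point L f) _ v' usites_s (sites_later s (fun _ h => h)).
congr (_%:E); rewrite -mulrA; congr (_ * _).
rewrite big_cat /=; congr (_ * _); last first.
  by apply: eq_big_seq => ij /v's ->.
rewrite big_map big_enum /=; apply: eq_bigr => j _.
by rewrite /geom /step_weight le /= -v'row.
Qed.

Lemma growth_is0 y : growth_is 0 y = if x == y then setT else set0.
Proof.
case: eqP => [<-|ne].
  by apply/seteqP; split=> // t _; apply/growth_vectorP.
apply/seteqP; split=> // t /growth_vectorP e; apply: ne.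
by apply: val_inj; apply: (@eq_from_nth _ 0); rewrite !size_tuple.
Qed.

Lemma trivIset_row_cell m q L K (D : set {ffun 'I_N -> 'I_K}) :
  trivIset D (fun f => row_cell m q L f).
Proof.
apply/trivIsetP => f f' _ _ ne; apply/seteqP; split=> // t [[g _] [g' _]].
have e := growth_is_inj g g'; case/eqP: ne; apply/ffunP => i; apply: val_inj.
by have := nth_box_point L f i; rewrite e nth_box_point => /addrI [].
Qed.

Lemma growth_indep_step m (q : N.-tuple int) (L : int) K s v : growth_indep_at m -> uniq s ->
  (forall ij, ij \in s -> (m.+1 < ij.1)%N /\ (1 <= ij.2)%N) ->
  (forall n, (n < N)%N -> L <= nth 0 x n) ->
  (forall n, (n < N)%N -> nth 0 q n < L + K%:Z) ->
  measurable (growth_is m.+1 q) /\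
  P (growth_is m.+1 q `&` weights_are s v) =
   ((\sum_(f : {ffun 'I_N -> 'I_K})
       fine (P (growth_is m (box_point L f))) * row_weight m q L f) *
    \prod_(ij <- s) geom ij (v ij))%:E.
Proof.
move=> IH us hs Lx qK; rewrite (growth_is_step _ Lx qK).
have mc f : measurable (@row_cell m q L K f).
  by have [] := @row_cell_indep m q L K f s v IH us hs.
split; first by apply: fin_bigcup_measurable; [exact: finite_seq|move=> f _; exact: mc].
rewrite setI_bigcupl measure_fin_bigcup; first last.
- by move=> f _; apply: measurableI; [exact: mc|exact: measurable_weights].
- by apply: trivIset_setIr; exact: trivIset_row_cell.
- exact: finite_seq.
rewrite -fsbig_seq ?enum_uniq // big_enum /= mulr_suml -sumEFin; apply: eq_bigr => f _.
by have [_ ->] := @row_cell_indep m q L K f s v IH us hs.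
Qed.

Lemma growth_indep m : growth_indep_at m.
Proof.
elim: m => [|m IH] y s v us hs.
  rewrite growth_is0; case: eqP => _; rewrite ?setTI ?set0I ?measure0; split=> //.
  - by rewrite weights_are_prob // probability_setT mul1r.
  - by rewrite mul0r.
have [L [K LK]] := exists_box (x ++ y).
have Lx n : (n < N)%N -> L <= nth 0 x n.
  move=> nN; have /LK /andP [] // : nth 0 x n \in x ++ y.
  by rewrite mem_cat mem_nth ?size_tuple.
have yK n : (n < N)%N -> nth 0 y n < L + K%:Z.
  move=> nN; have /LK /andP [] // : nth 0 y n \in x ++ y.
  by rewrite mem_cat orbC mem_nth ?size_tuple.
have [mG ->] := growth_indep_step v IH us hs Lx yK; split=> //.
have [_] := growth_indep_step (s := [::]) v IH isT (fun _ h => match notF h with end) Lx yK.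
by rewrite weights_are_nil setIT big_nil mulr1 => ->.
Qed.

Lemma growth_law_step m (q : N.-tuple int) (L : int) K :
  (forall n, (n < N)%N -> L <= nth 0 x n) ->
  (forall n, (n < N)%N -> nth 0 q n < L + K%:Z) ->
  fine (P (growth_is m.+1 q)) =
  \sum_(f : {ffun 'I_N -> 'I_K})
       fine (P (growth_is m (box_point L f))) * row_weight m q L f.
Proof.
move=> Lx qK.
have [_] := growth_indep_step (s := [::]) (fun=> 0%N) (@growth_indep m) isT
  (fun _ h => match notF h with end) Lx qK.
by rewrite weights_are_nil setIT big_nil mulr1 => ->.
Qed.

Lemma growth_is_unsorted m y : x \in weyl_chamber -> y \notin weyl_chamber ->
  growth_is m y = set0.
Proof.
move=> hx hy; apply/seteqP; split=> // t /growth_vectorP e; case/negP: hy.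
apply/(sortedP 0) => i; rewrite size_tuple => iN.
by rewrite -!e // ?(ltnW iN) //; apply: height_sorted.
Qed.

End Law.

(** * Means over a circle *)

Section CircleMean.
Variable R : realType.
Implicit Types (h g : R -> R[i]) (z c : R[i]).
Local Notation Re := (@complex.Re R).
Local Notation Im := (@complex.Im R).
Local Notation mu := (@lebesgue_measure R).
Local Notation I2pi := (`[0, 2 * pi]%classic : set R).

Lemma ReD z c : Re (z + c) = Re z + Re c. Proof. by case: z c => ? ? []. Qed.
Lemma ImD z c : Im (z + c) = Im z + Im c. Proof. by case: z c => ? ? []. Qed.
Lemma ReM z c : Re (z * c) = Re z * Re c - Im z * Im c.
Proof. by case: z c => ? ? []. Qed.
Lemma ImM z c : Im (z * c) = Re z * Im c + Im z * Re c.
Proof. by case: z c => ? ? []. Qed.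

(** Continuity of the two real components, which is what the integrals of the
    components require. *)
Definition ccontinuous h := continuous (Re \o h) /\ continuous (Im \o h).

Lemma ccontinuous_cst c : ccontinuous (fun=> c).
Proof. by split=> t; exact: cvg_cst. Qed.

Lemma ccontinuousD h g : ccontinuous h -> ccontinuous g ->
  ccontinuous (fun t => h t + g t).
Proof.
move=> [h1 h2] [g1 g2]; split.
  have -> : Re \o (fun t => h t + g t) = (Re \o h) \+ (Re \o g).
    by apply/funext => t /=; rewrite ReD.
  by move=> t; apply: cvgD; [exact: h1|exact: g1].
have -> : Im \o (fun t => h t + g t) = (Im \o h) \+ (Im \o g).
  by apply/funext => t /=; rewrite ImD.
by move=> t; apply: cvgD; [exact: h2|exact: g2].
Qed.

Lemma ccontinuousM h g : ccontinuous h -> ccontinuous g ->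
  ccontinuous (fun t => h t * g t).
Proof.
move=> [h1 h2] [g1 g2]; split.
  have -> : Re \o (fun t => h t * g t)
      = (fun t => (Re \o h) t * (Re \o g) t - (Im \o h) t * (Im \o g) t).
    by apply/funext => t /=; rewrite ReM.
  by move=> t; apply: cvgB; apply: cvgM; [exact: h1|exact: g1|exact: h2|exact: g2].
have -> : Im \o (fun t => h t * g t)
    = (fun t => (Re \o h) t * (Im \o g) t + (Im \o h) t * (Re \o g) t).
  by apply/funext => t /=; rewrite ImM.
by move=> t; apply: cvgD; apply: cvgM; [exact: h1|exact: g2|exact: h2|exact: g1].
Qed.

Lemma ccontinuousV h : (forall t, h t != 0) -> ccontinuous h ->
  ccontinuous (fun t => (h t)^-1).
Proof.
move=> h0 [h1 h2].
have nz t : (Re \o h) t * (Re \o h) t + (Im \o h) t * (Im \o h) t != 0.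
  have := h0 t; rewrite /=; case: (h t) => u v /=.
  apply: contraNneq => e; rewrite eq_complex /=.
  by apply/andP; split; nra.
have cD : continuous (fun t => ((Re \o h) t * (Re \o h) t + (Im \o h) t * (Im \o h) t)^-1).
  move=> t; apply: cvgV; first exact: nz.
  by apply: cvgD; apply: cvgM; [exact: h1|exact: h1|exact: h2|exact: h2].
split.
  have -> : Re \o (fun t => (h t)^-1) = (fun t => (Re \o h) t *
      ((Re \o h) t * (Re \o h) t + (Im \o h) t * (Im \o h) t)^-1).
    by apply/funext => t /=; case: (h t) => u v /=; rewrite -!expr2.
  by move=> t; apply: cvgM; [exact: h1|exact: cD].
have -> : Im \o (fun t => (h t)^-1) = (fun t => - (Im \o h) t *
      ((Re \o h) t * (Re \o h) t + (Im \o h) t * (Im \o h) t)^-1).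
  by apply/funext => t /=; case: (h t) => u v /=; rewrite -!expr2 mulNr.
by move=> t; apply: cvgM; [apply: cvgN; exact: h2|exact: cD].
Qed.

Lemma ccontinuousX h n : ccontinuous h -> ccontinuous (fun t => h t ^+ n).
Proof.
move=> ch; elim: n => [|n IH].
  by under eq_fun do rewrite expr0; exact: ccontinuous_cst.
by under eq_fun do rewrite exprS; apply: ccontinuousM.
Qed.

Lemma ccontinuous_exprz h (n : int) : (forall t, h t != 0) -> ccontinuous h ->
  ccontinuous (fun t => h t ^ n).
Proof.
move=> h0 ch; case: n => n.
  by have := ccontinuousX n ch.
have := ccontinuousV _ (ccontinuousX n.+1 ch); apply => t.
by rewrite expf_neq0.
Qed.

Lemma ccontinuous_prod (I : Type) (s : seq I) (f : I -> R -> R[i]) :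
  (forall i, ccontinuous (f i)) -> ccontinuous (fun t => \prod_(i <- s) f i t).
Proof.
move=> cf; elim: s => [|i s IH].
  by under eq_fun do rewrite big_nil; exact: ccontinuous_cst.
by under eq_fun do rewrite big_cons; apply: ccontinuousM.
Qed.

Lemma integrable_I2pi (f : R -> R) : continuous f -> mu.-integrable I2pi (EFin \o f).
Proof.
move=> cf; apply: continuous_compact_integrable; first exact: segment_compact.
exact: continuous_subspaceT.
Qed.

(** For h t = f (r e^(it)) this is the integral of f(z) dz / (2 pi i z) along the
    circle. *)
Definition circle_mean h : R[i] := (2 * pi%:C)^-1 * complex_integral I2pi h.

Lemma complex_integralD h g : ccontinuous h -> ccontinuous g ->
  complex_integral I2pi (fun t => h t + g t)
  = complex_integral I2pi h + complex_integral I2pi g.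
Proof.
move=> [h1 h2] [g1 g2]; rewrite /complex_integral; apply/eqP; rewrite eq_complex /=.
apply/andP; split; apply/eqP.
  rewrite -RintegralD //; try exact: integrable_I2pi.
  by apply: eq_Rintegral => t _; rewrite ReD.
rewrite -RintegralD //; try exact: integrable_I2pi.
by apply: eq_Rintegral => t _; rewrite ImD.
Qed.

Lemma complex_integralZ c h : ccontinuous h ->
  complex_integral I2pi (fun t => c * h t) = c * complex_integral I2pi h.
Proof.
move=> [h1 h2]; rewrite /complex_integral; case: c => u v.
have cZ (k : R) (f : R -> R) : continuous f -> continuous (fun t => k * f t).
  by move=> cf t; apply: cvgM; [exact: cvg_cst|exact: cf].
apply/eqP; rewrite eq_complex /=; apply/andP; split; apply/eqP.
  rewrite -!RintegralZl //; try exact: integrable_I2pi.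
  rewrite -RintegralB //; try (apply: integrable_I2pi; exact: cZ).
  by apply: eq_Rintegral => t _; rewrite ReM.
rewrite -!RintegralZl //; try exact: integrable_I2pi.
rewrite -RintegralD //; try (apply: integrable_I2pi; exact: cZ).
by apply: eq_Rintegral => t _; rewrite ImM.
Qed.

Lemma circle_meanD h g : ccontinuous h -> ccontinuous g ->
  circle_mean (fun t => h t + g t) = circle_mean h + circle_mean g.
Proof. by move=> ch cg; rewrite /circle_mean complex_integralD // mulrDr. Qed.

Lemma circle_meanZ c h : ccontinuous h ->
  circle_mean (fun t => c * h t) = c * circle_mean h.
Proof. by move=> ch; rewrite /circle_mean complex_integralZ // mulrCA. Qed.

Lemma normc_ge_ReIm z : `|Re z| <= normc z /\ `|Im z| <= normc z.
Proof.
case: z => u v /=; split; rewrite -sqrtr_sqr ler_wsqrtr //; nra.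
Qed.

Lemma normc_le_ReIm z : normc z <= `|Re z| + `|Im z|.
Proof.
case: z => u v /=; rewrite -[leRHS]ger0_norm ?addr_ge0 //.
rewrite -sqrtr_sqr ler_wsqrtr // sqrrD !real_normK ?num_real //.
by rewrite -addrA [_ *+ 2 + _]addrC addrA lerDl mulrn_wge0 ?mulr_ge0.
Qed.

(** A single constant C serves all functions dominated by a multiple of h; it is
    applied to g = z^p h, for all p at once. *)
Lemma circle_mean_bound h : ccontinuous h ->
  exists2 C : R, 0 <= C & forall g (K : R), 0 <= K -> ccontinuous g ->
    (forall t, normc (g t) <= K * normc (h t)) ->
    normc (circle_mean g) <= K * C.
Proof.
move=> [h1 h2].
pose B (f : R -> R) := \int[mu]_(t in I2pi) f t.
pose s t := 1 + ((Re \o h) t * (Re \o h) t + (Im \o h) t * (Im \o h) t).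
have cs : continuous s.
  move=> t; apply: cvgD; first exact: cvg_cst.
  by apply: cvgD; apply: cvgM; [exact: h1|exact: h1|exact: h2|exact: h2].
have cKs (K : R) : continuous (fun t => K * s t).
  by move=> t; apply: cvgM; [exact: cvg_cst|exact: cs].
have s0 t : 0 <= s t by rewrite /s; nra.
have B0 : 0 <= B s by apply: Rintegral_ge0.
have hs t : normc (h t) <= s t.
  rewrite /s /=; case: (h t) => u v /=; rewrite -!expr2.
  set w := u ^+ 2 + v ^+ 2; have w0 : 0 <= w by rewrite /w; nra.
  have := sqr_sqrtr w0; have := sqrtr_ge0 w; nra.
pose k := normc ((2 * pi%:C)^-1 : R[i]).
have k0 : 0 <= k by rewrite /k; case: (_^-1) => u v /=; exact: sqrtr_ge0.
exists (k * (B s + B s)); first by rewrite mulr_ge0 ?addr_ge0.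
move=> g K K0 [g1 g2] gK.
rewrite /circle_mean normcM -/k mulrCA ler_wpM2l // [K * (B s + B s)]mulrDr.
apply: le_trans (normc_le_ReIm _) _.
have bnd (f : R -> R) : continuous f -> (forall t, `|f t| <= normc (g t)) ->
    `|B f| <= K * B s.
  move=> cf fg; apply: le_trans (le_normr_Rintegral _ _) _ => //.
    exact: integrable_I2pi.
  rewrite -RintegralZl //; last exact: integrable_I2pi.
  apply: le_Rintegral => //; try exact: integrable_I2pi.
    by apply: integrable_I2pi => t; apply: cvg_norm; exact: cf.
  move=> t _; apply: le_trans (fg t) _; apply: le_trans (gK t) _.
  by rewrite ler_wpM2l.
apply: lerD; [apply: (bnd (Re \o g))|apply: (bnd (Im \o g))] => // t.
  by have [] := normc_ge_ReIm (g t).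
by have [] := normc_ge_ReIm (g t).
Qed.

Definition circle_point (r t : R) : R[i] := (r * cos t) +i* (r * sin t).

Lemma ccontinuous_circle r : ccontinuous (circle_point r).
Proof.
split=> t.
  by apply: (@cvgM _ _ _ _ (fun=> r) cos); [exact: cvg_cst|exact: continuous_cos].
by apply: (@cvgM _ _ _ _ (fun=> r) sin); [exact: cvg_cst|exact: continuous_sin].
Qed.

Lemma circle_pointX r t n :
  circle_point r t ^+ n = (r ^+ n * cos (t *+ n)) +i* (r ^+ n * sin (t *+ n)).
Proof.
elim: n => [|n IH]; first by rewrite !expr0 mulr0n cos0 sin0 mulr1 mulr0.
rewrite exprS IH mulrS cosD sinD; apply/eqP; rewrite eq_complex /= exprS.
by apply/andP; split; apply/eqP; ring.
Qed.

Lemma normc_circle r t : 0 < r -> normc (circle_point r t) = r.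
Proof.
move=> r0 /=; rewrite !exprMn -mulrDr cos2Dsin2 mulr1 sqrtr_sqr gtr0_norm //.
Qed.

Lemma circle_point_neq0 r t : 0 < r -> circle_point r t != 0.
Proof.
move=> r0; apply/eqP => e; have := normc_circle t r0; rewrite e normc0.
by move=> e'; rewrite -e' ltxx in r0.
Qed.

Lemma circle_pointV r t : 0 < r ->
  (circle_point r t)^-1 = (r^-1 * cos t) +i* (- (r^-1 * sin t)).
Proof.
move=> r0; have r1 : r != 0 by rewrite gt_eqF.
have -> : (r^-1 * cos t) +i* (- (r^-1 * sin t)) = circle_point r^-1 (- t).
  by rewrite /circle_point cosN sinN mulrN.
apply: (mulfI (circle_point_neq0 t r0)); rewrite mulfV ?circle_point_neq0 //.
apply/eqP; rewrite eq_complex /= cosN sinN; apply/andP; split; apply/eqP.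
  have := cos2Dsin2 t; rewrite !expr2 => h.
  have -> : r * cos t * (r^-1 * cos t) - r * sin t * (r^-1 * - sin t)
    = (cos t * cos t + sin t * sin t) by field.
  by rewrite h.
by field.
Qed.

Lemma Rintegral_derive_eq0 (f F : R -> R) : continuous f ->
  (forall t : R, is_derive t 1 F (f t)) -> F (2 * pi) = F 0 ->
  \int[mu]_(t in I2pi) f t = 0.
Proof.
move=> cf dF F0.
have pi20 : 0 < 2 * pi :> R by rewrite mulr_gt0 ?pi_gt0.
have dv t : derivable F t 1 by have [] := dF t.
have cF t : F @ t --> F t by apply/differentiable_continuous/derivable1_diffP.
rewrite /Rintegral (@continuous_FTC2 _ _ F) //.
- by rewrite F0 subee.
- exact: continuous_subspaceT.
- by split; [move=> t _|apply: cvg_at_right_filter|apply: cvg_at_left_filter].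
- by move=> t _; rewrite derive1E; have [] := dF t.
Qed.

Lemma integral_cos_sin n : (0 < n)%N ->
  \int[mu]_(t in I2pi) cos (t *+ n) = 0 /\ \int[mu]_(t in I2pi) sin (t *+ n) = 0.
Proof.
move=> n0.
have nR : n%:R != 0 :> R by rewrite pnatr_eq0 -lt0n.
have dn (t : R) : is_derive t 1 (fun t : R => t *+ n) n%:R.
  have := @is_deriveZ _ _ _ _ n%:R _ _ _ (is_derive_id t 1).
  rewrite /GRing.scale /= mulr1; congr (is_derive _ _ _ _).
  by apply/funext => s; exact: mulr_natl.
have cn : continuous (fun t : R => t *+ n).
  move=> t; have [d _] := dn t.
  exact/differentiable_continuous/derivable1_diffP.
have per (f : R -> R) : periodic f (pi *+ 2) -> f ((2 * pi) *+ n) = f (0 *+ n).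
  by move=> fp; rewrite mulr_natl -[in LHS](add0r (_ *+ n)) periodicn // mul0rn.
split.
  apply: (@Rintegral_derive_eq0 _ (fun t : R => n%:R^-1 * sin (t *+ n))).
  - by move=> t; apply: continuous_comp; [exact: cn|exact: continuous_cos].
  - move=> t.
    have h := @is_derive1_comp _ sin (fun t : R => t *+ n) t _ _ (is_derive_sin _) (dn t).
    have := @is_deriveZ _ _ _ _ n%:R^-1 _ _ _ h.
    by rewrite /GRing.scale /= [_ * n%:R]mulrC mulKf.
  - by rewrite per //; exact: sinD2pi.
apply: (@Rintegral_derive_eq0 _ (fun t : R => - n%:R^-1 * cos (t *+ n))).
- by move=> t; apply: continuous_comp; [exact: cn|exact: continuous_sin].
- move=> t.
  have h := @is_derive1_comp _ cos (fun t : R => t *+ n) t _ _ (is_derive_cos _) (dn t).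
  have := @is_deriveZ _ _ _ _ (- n%:R^-1) _ _ _ h.
  by rewrite /GRing.scale /= !mulNr mulrN opprK [_ * n%:R]mulrC mulKf.
- by rewrite per //; exact: cosD2pi.
Qed.

Lemma twopi_neq0 : 2 * pi%:C != 0 :> R[i].
Proof.
rewrite mulf_neq0 ?pnatr_eq0 // eq_complex /= eqxx andbT gt_eqF //.
exact: pi_gt0.
Qed.

Lemma complex_integral_trig (k l : R) n : (0 < n)%N ->
  complex_integral I2pi (fun t => (k * cos (t *+ n)) +i* (l * sin (t *+ n))) = 0.
Proof.
move=> n0; have [ci si] := integral_cos_sin n0.
have cn : continuous (fun t : R => t *+ n).
  by move=> t; apply: (@natmul_continuous R R n).
rewrite /complex_integral /= !RintegralZl //.
- by rewrite ci si !mulr0.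
- by apply: integrable_I2pi => t; apply: continuous_comp; [exact: cn|exact: continuous_sin].
- by apply: integrable_I2pi => t; apply: continuous_comp; [exact: cn|exact: continuous_cos].
Qed.

Lemma circle_mean_exprz (r : R) (n : int) : 0 < r ->
  circle_mean (fun t => circle_point r t ^ n) = (n == 0)%:R.
Proof.
move=> r0; rewrite /circle_mean; case: n => [[|n]|n].
- rewrite /complex_integral eqxx.
  under eq_Rintegral do rewrite expr0z /=.
  under [X in _ +i* X]eq_Rintegral do rewrite expr0z /=.
  rewrite !Rintegral_cst //= mul0r mul1r lebesgue_measure_itv /= lte_fin.
  rewrite mulr_gt0 ?pi_gt0 // oppr0 addr0 /= -[RHS](mulVf twopi_neq0).
  by congr (_ * _); apply/eqP; rewrite eq_complex /=; apply/andP; split; apply/eqP; ring.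
- have -> : (fun t => circle_point r t ^ n.+1%:Z) =
    (fun t => (r ^+ n.+1 * cos (t *+ n.+1)) +i* (r ^+ n.+1 * sin (t *+ n.+1))).
    by apply/funext => t; rewrite -circle_pointX.
  by rewrite complex_integral_trig // mulr0.
- have -> : (fun t => circle_point r t ^ Negz n) =
    (fun t => ((r ^+ n.+1)^-1 * cos (t *+ n.+1)) +i* (- (r ^+ n.+1)^-1 * sin (t *+ n.+1))).
    apply/funext => t; rewrite NegzE -exprnN circle_pointX.
    by rewrite -/(circle_point _ _) circle_pointV ?exprn_gt0 // mulNr.
  by rewrite complex_integral_trig // mulr0.
Qed.

Lemma normcX z n : normc (z ^+ n) = normc z ^+ n.
Proof.
by elim: n => [|n IH]; rewrite ?expr0 ?normc1 // !exprS normcM IH.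
Qed.

Lemma normc_exprz z (n : int) : normc (z ^ n) = normc z ^ n.
Proof.
case: n => n; first exact: normcX.
by rewrite NegzE -!exprnN normcV normcX.
Qed.

Lemma le0_geometric (X q B : R) : 0 <= q < 1 -> (forall k, X <= q ^+ k * B) -> X <= 0.
Proof.
move=> /andP [q0 q1] XB.
have cq : GRing.exp q @ \oo --> (0 : R) by apply: cvg_expr; rewrite ger0_norm.
have cB : (fun k => q ^+ k * B) @ \oo --> 0 * B.
  by apply: cvgM; [exact: cq|exact: cvg_cst].
rewrite mul0r in cB.
by apply: (cvgr_to_ge cB); apply: nearW.
Qed.

Lemma normc_ge0 z : 0 <= normc z.
Proof. by case: z => u v; exact: sqrtr_ge0. Qed.

(** Where v vanishes, w p = c^k w (p - k) for every k, and the bound gives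
    |w p| <= C r^p (|c| / r)^k, which tends to 0 with k.  This replaces the
    deformation of the contour to infinity. *)
Lemma decay_eq0 (r C : R) c (w v : int -> R[i]) (p0 : int) :
  0 < r -> normc c < r ->
  (forall p, w p = c * w (p - 1) + v p) ->
  (forall p, p <= p0 -> v p = 0) ->
  (forall p, normc (w p) <= r ^ p * C) ->
  forall p, p <= p0 -> w p = 0.
Proof.
move=> r0 cr wv v0 wC p pp.
have wk k : w p = c ^+ k * w (p - k%:Z).
  elim: k => [|k IH]; first by rewrite expr0 mul1r subr0.
  rewrite IH wv v0 ?addr0; last by lia.
  rewrite mulrA exprSr; congr (_ * w _); lia.
apply: eq0_normc; apply/eqP; rewrite eq_le normc_ge0 andbT.
apply: (@le0_geometric _ (normc c / r) (r ^ p * C)).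
  by rewrite divr_ge0 ?normc_ge0 ?(ltW r0) // ltr_pdivrMr ?mul1r.
move=> k; rewrite (wk k) normcM normcX exprMn -mulrA.
apply: ler_wpM2l; first by rewrite exprn_ge0 ?normc_ge0.
apply: le_trans (wC _) _; rewrite mulrA expfzDr ?gt_eqF //.
by rewrite exprVn exprnN [_ ^ p * _]mulrC.
Qed.

End CircleMean.

(** * The contour integrals *)

Section KernelMoments.
Variables (R : realType) (a b : nat -> R) (N : nat) (x : N.-tuple int) (r : R).
Hypothesis ha : forall i : nat, (1 <= i)%N -> 0 <= a i <= 1.
Hypothesis hb : forall j : nat, (1 <= j)%N -> 0 <= b j <= 1.
Hypothesis hab : forall i j : nat, (1 <= i)%N -> (1 <= j)%N -> 0 < a i * b j < 1.
Hypothesis hN : (1 <= N)%N.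
Hypothesis hr : forall k : nat, (1 <= k <= N)%N -> (b k)^-1 < r.

Lemma a_gt0 i : (1 <= i)%N -> 0 < a i.
Proof.
move=> i1; have /andP [a0 _] := ha i1; rewrite lt_def a0 andbT.
by apply/eqP => e; have := hab i1 (leqnn 1); rewrite e mul0r ltxx.
Qed.

Lemma b_gt0 j : (1 <= j)%N -> 0 < b j.
Proof.
move=> j1; have /andP [b0 _] := hb j1; rewrite lt_def b0 andbT.
by apply/eqP => e; have := hab (leqnn 1) j1; rewrite e mulr0 ltxx.
Qed.

Lemma radius_gt1 : 1 < r.
Proof.
apply: le_lt_trans (hr (k := 1) _); last by rewrite leqnn hN.
by rewrite invf_ge1 ?b_gt0 //; have /andP [] := hb (leqnn 1).
Qed.

Lemma radius_gt0 : 0 < r. Proof. exact: lt_trans ltr01 radius_gt1. Qed.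

(** The integrand of the kernel without its normalisation, with the exponent of z
    as a free parameter. *)
Definition circle_integrand (i m j : nat) (p : int) (t : R) : R[i] :=
  let z := circle_point r t in
  z ^ p * ((z * (b i)%:C) ^ component x i)^-1 *
  (\prod_(1 <= k < j.+1) (z - (b k)%:C^-1)) *
  (\prod_(1 <= k < i.+1) (z - (b k)%:C^-1))^-1 *
  (\prod_(1 <= k < m.+1) (1 - (a k)%:C / z))^-1.

Definition moment i m j p : R[i] := circle_mean (circle_integrand i m j p).

Lemma real_complex_neq0 (u : R) : u != 0 -> u%:C != 0.
Proof. by move=> u0; rewrite eq_complex /= eqxx andbT. Qed.

Lemma circle_neq_real (u t : R) : `|u| < r -> circle_point r t - u%:C != 0.
Proof.
move=> ur; rewrite subr_eq0; apply/eqP => e.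
have := normc_circle t radius_gt0; rewrite e /= expr0n /= addr0 sqrtr_sqr => e'.
by rewrite e' ltxx in ur.
Qed.

Lemma factor_b_neq0 k t : (1 <= k <= N)%N -> circle_point r t - (b k)%:C^-1 != 0.
Proof.
move=> kN; rewrite -fmorphV circle_neq_real // gtr0_norm ?hr //.
by rewrite invr_gt0 b_gt0 //; case/andP: kN.
Qed.

Lemma factor_a_neq0 k t : (1 <= k)%N -> 1 - (a k)%:C / circle_point r t != 0.
Proof.
move=> k1; have z0 := circle_point_neq0 t radius_gt0.
rewrite -(divff z0) -mulrBl mulf_neq0 ?invr_neq0 // circle_neq_real //.
rewrite gtr0_norm ?a_gt0 //; apply: le_lt_trans radius_gt1.
by case/andP: (ha k1).
Qed.

Lemma prod_b_neq0 i t : (i <= N)%N ->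
  \prod_(1 <= k < i.+1) (circle_point r t - (b k)%:C^-1) != 0.
Proof.
move=> iN; rewrite prodf_seq_neq0; apply/allP => k; rewrite mem_index_iota /= => h.
by apply: factor_b_neq0; lia.
Qed.

Lemma prod_a_neq0 m t : \prod_(1 <= k < m.+1) (1 - (a k)%:C / circle_point r t) != 0.
Proof.
rewrite prodf_seq_neq0; apply/allP => k; rewrite mem_index_iota /= => h.
by apply: factor_a_neq0; lia.
Qed.

Lemma circle_b_neq0 i t : (1 <= i)%N -> circle_point r t * (b i)%:C != 0.
Proof.
move=> i1; rewrite mulf_neq0 ?circle_point_neq0 ?radius_gt0 //.
by rewrite real_complex_neq0 // gt_eqF ?b_gt0.
Qed.

Lemma ccontinuous_integrand i m j p : (1 <= i <= N)%N ->
  ccontinuous (circle_integrand i m j p).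
Proof.
move=> /andP [i1 iN]; rewrite /circle_integrand /=.
have cz := ccontinuous_circle r.
have cB k : ccontinuous (fun t => circle_point r t - (b k)%:C^-1).
  by apply: ccontinuousD => //; exact: ccontinuous_cst.
apply: ccontinuousM; [apply: ccontinuousM; [apply: ccontinuousM; [apply: ccontinuousM|]|]|].
- by apply: ccontinuous_exprz => // t; exact: circle_point_neq0 radius_gt0.
- apply: ccontinuousV.
    by move=> t; rewrite expfz_neq0 ?circle_b_neq0.
  apply: ccontinuous_exprz; first by move=> t; rewrite circle_b_neq0.
  by apply: ccontinuousM => //; exact: ccontinuous_cst.
- exact: ccontinuous_prod.
- apply: ccontinuousV; first by move=> t; exact: prod_b_neq0.
  exact: ccontinuous_prod.
- apply: ccontinuousV; first by move=> t; exact: prod_a_neq0.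
  apply: ccontinuous_prod => k.
  apply: ccontinuousD; first exact: ccontinuous_cst.
  under eq_fun do rewrite -mulNr.
  apply: ccontinuousM; first exact: ccontinuous_cst.
  by apply: ccontinuousV => // t; exact: circle_point_neq0 radius_gt0.
Qed.

Lemma moment_col i m j p : (1 <= i <= N)%N ->
  moment i m j.+1 p = moment i m j (p + 1) - (b j.+1)%:C^-1 * moment i m j p.
Proof.
move=> hi; rewrite /moment -mulNr -circle_meanZ; last exact: ccontinuous_integrand.
rewrite -circle_meanD; first last.
- by apply: ccontinuousM; [exact: ccontinuous_cst|exact: ccontinuous_integrand].
- exact: ccontinuous_integrand.
congr circle_mean; apply/funext => t; rewrite /circle_integrand /=.
rewrite (big_nat_recr j.+1) //= exprz_addr1 ?circle_point_neq0 ?radius_gt0 //.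
set P := \prod_(_ <= _ < j.+1) _; set Q := (\prod_(_ <= _ < i.+1) _)^-1.
set S := (\prod_(_ <= _ < m.+1) _)^-1; set X := (_ ^ component x i)^-1.
by set B := (b j.+1)%:C^-1; ring.
Qed.

Lemma moment_row i m j p : (1 <= i <= N)%N ->
  moment i m.+1 j p = (a m.+1)%:C * moment i m.+1 j (p - 1) + moment i m j p.
Proof.
move=> hi; rewrite /moment -circle_meanZ; last exact: ccontinuous_integrand.
rewrite -circle_meanD; first last.
- exact: ccontinuous_integrand.
- by apply: ccontinuousM; [exact: ccontinuous_cst|exact: ccontinuous_integrand].
congr circle_mean; apply/funext => t; rewrite /circle_integrand /=.
have z0 := circle_point_neq0 t radius_gt0; have a1 := factor_a_neq0 t (ltn0Sn m).
have A0 := prod_a_neq0 m t.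
rewrite (big_nat_recr m.+1) //=.
have -> : circle_point r t ^ p = circle_point r t ^ (p - 1) * circle_point r t.
  by rewrite -exprz_addr1 // subrK.
move: z0 a1 A0; set z := circle_point r t; set A := \prod_(_ <= _ < m.+1) _.
set B := (\prod_(1 <= k < i.+1) _)^-1; set B' := \prod_(_ <= _ < _) _.
set X := (_ ^ component x i)^-1; set Y := z ^ (p - 1).
rewrite -[1 - _ / z]/(1 - _ * _) => z0 a1 A0.
have a2 : z - (a m.+1)%:C != 0.
  apply: contraNneq a1 => e; move/eqP: e; rewrite subr_eq0 => /eqP <-.
  by rewrite mulfV // subrr.
by field; rewrite z0 a2 A0.
Qed.

Lemma moment_bound i m j : (1 <= i <= N)%N ->
  exists C : R, forall p, normc (moment i m j p) <= r ^ p * C.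
Proof.
move=> hi; have [C C0 HC] := circle_mean_bound (ccontinuous_integrand m j 0 hi).
exists C => p; apply: HC.
- by rewrite exprz_ge0 // ltW // radius_gt0.
- exact: ccontinuous_integrand.
move=> t; rewrite /circle_integrand /= expr0z mul1r -!mulrA normcM normc_exprz.
by rewrite normc_circle ?radius_gt0.
Qed.

(** All factors z - 1/b_k cancel, leaving a single power of z. *)
Lemma moment_diag i p : (1 <= i <= N)%N ->
  moment i 0 i p = (b i)%:C ^ (- component x i) * (p == component x i)%:R.
Proof.
move=> hi; have /andP [i1 iN] := hi.
rewrite -subr_eq0 -(circle_mean_exprz _ radius_gt0) /moment.
rewrite -circle_meanZ; last first.
  apply: ccontinuous_exprz; last exact: ccontinuous_circle.
  by move=> t; exact: circle_point_neq0 radius_gt0.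
congr circle_mean; apply/funext => t; rewrite /circle_integrand /=.
rewrite [\prod_(1 <= k < 1) _]big_geq // invr1 mulr1 mulfK ?prod_b_neq0 //.
have z0 := circle_point_neq0 t radius_gt0.
move: z0; set xi := component x i; move: (circle_point r t) (b i)%:C => z c z0.
rewrite [(z * c) ^ xi]expfzMl invfM [z ^ (p - xi)](expfzDr _ _ z0) !invr_expz.
by rewrite [RHS]mulrC mulrA.
Qed.

End KernelMoments.

(** * The determinant of contour integrals *)

Section KernelDet.
Variables (R : realType) (a b : nat -> R) (N : nat) (x : N.-tuple int) (r : R).
Hypothesis ha : forall i : nat, (1 <= i)%N -> 0 <= a i <= 1.
Hypothesis hb : forall j : nat, (1 <= j)%N -> 0 <= b j <= 1.
Hypothesis hab : forall i j : nat, (1 <= i)%N -> (1 <= j)%N -> 0 < a i * b j < 1.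
Hypothesis hN : (1 <= N)%N.
Hypothesis hr : forall k : nat, (1 <= k <= N)%N -> (b k)^-1 < r.

Let aC k := (a k)%:C.
Let bC k := (b k)%:C.
Let Psi (i : 'I_N) m j p := moment a b x r i.+1 m j p.
Let r0 := radius_gt0 hb hab hN hr.

(** On the circle dz = i z dt, so that dz / z becomes i dt. *)
Lemma kernelME m (y : N.-tuple int) (i j : 'I_N) :
  kernelM a b m r x y i.+1 j.+1 = kernel_entry aC bC Psi i m j (component y j.+1).
Proof.
have hi : (1 <= i.+1 <= N)%N by rewrite ltn_ord.
have ci := ccontinuous_integrand x ha hb hab hN hr m j.+1 (component y j.+1) hi.
set K := \prod_(1 <= k < m.+1) (1 - aC k * bC j.+1) * bC j.+1 ^ component y j.+1.
rewrite /kernelM /circle_integral.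
transitivity ((2 * pi%:C * 'i%C)^-1 * complex_integral `[0, 2 * pi]
    (fun t => ('i%C * K) * circle_integrand a b x r i.+1 m j.+1 (component y j.+1) t)).
  congr (_ * complex_integral _ _); apply/funext => t.
  rewrite -/(circle_point r t) /circle_integrand /= prodf_div.
  have -> : \prod_(1 <= k < m.+1) (1 - (a k * b j.+1)%:C) =
      \prod_(1 <= k < m.+1) (1 - aC k * bC j.+1).
    by apply: eq_bigr => k _; rewrite rmorphM.
  have z0 := circle_point_neq0 t r0.
  rewrite [(circle_point r t * _) ^ component y j.+1]expfzMl /K /bC.
  move: z0 => /divff; rewrite mulrC; set zi := _^-1; set z := circle_point r t.
  set A := \prod_(_ <= _ < m.+1) _; set B := (_ ^ component x i.+1)^-1.
  set D := \prod_(_ <= _ < j.+2) _; set G := (\prod_(_ <= _ < i.+2) _)^-1.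
  set H := (\prod_(_ <= _ < m.+1) _)^-1; set Y := _ ^ _; set Z := _ ^ _ => e.
  transitivity ((zi * z) * ('i%C * (A * Z) * (Y * B * D * G * H))); first by ring.
  by rewrite e mul1r.
rewrite complex_integralZ // /kernel_entry /Psi /moment /circle_mean -/K.
have i0 : 'i%C != 0 :> R[i] by rewrite eq_complex /= oner_eq0 andbF.
have pi0 := twopi_neq0 R.
set I := complex_integral _ _; set p2 := 2 * pi%:C; rewrite -/p2 in pi0.
by field; rewrite i0 pi0.
Qed.

Lemma bC_lt_radius k : (1 <= k <= N)%N -> normc ((bC k)^-1) < r.
Proof.
move=> hk; have b0 : 0 < b k by apply: b_gt0 hb hab _ _; case/andP: hk.
rewrite normcV /= expr0n /= addr0 sqrtr_sqr gtr0_norm //; exact: hr.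
Qed.

Lemma aC_lt_radius k : (1 <= k)%N -> normc (aC k) < r.
Proof.
move=> hk; have a0 := a_gt0 ha hab hk.
rewrite /= expr0n /= addr0 sqrtr_sqr gtr0_norm //.
by apply: le_lt_trans (radius_gt1 hb hab hN hr); case/andP: (ha hk).
Qed.

Let hi (i : 'I_N) : (1 <= i.+1 <= N)%N. Proof. by rewrite ltn_ord. Qed.

Lemma initial_moment_above (i : 'I_N) d p : nth 0 x i < p -> Psi i 0 (i.+1 + d) p = 0.
Proof.
elim: d p => [|d IH] p xp; rewrite /Psi.
  by rewrite addn0 (moment_diag x hb hab hN hr) // gt_eqF ?mulr0.
rewrite addnS (moment_col x ha hb hab hN hr) // -!/(Psi _ _ _ _) !IH ?mulr0 ?subr0 //.
by lia.
Qed.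

Lemma initial_moment_below (i : 'I_N) d p : p < nth 0 x i - d%:Z -> Psi i 0 (i.+1 + d) p = 0.
Proof.
elim: d p => [|d IH] p xp; rewrite /Psi.
  by rewrite addn0 (moment_diag x hb hab hN hr) // lt_eqF ?mulr0 //; move: xp; rewrite subr0.
rewrite addnS (moment_col x ha hb hab hN hr) // -!/(Psi _ _ _ _) !IH ?mulr0 ?subr0 //; lia.
Qed.

(** The integrand decays at infinity at least like z^(p - x_i - 1); the argument
    runs leftwards from the diagonal, each step dividing by one factor z - 1/b. *)
Lemma initial_moment_left (i : 'I_N) d j p : (j + d.+1)%N = i.+1 ->
  p <= nth 0 x i -> Psi i 0 j p = 0.
Proof.
elim: d j p => [|d IH] j p ji px.
all: have [C HC] := moment_bound x ha hb hab hN hr 0 j (hi i).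
all: apply: (decay_eq0 r0 (bC_lt_radius (k := j.+1) _)
  (w := fun p => Psi i 0 j p) (v := fun p => Psi i 0 j.+1 (p - 1)) _ _ HC px).
- by have := ltn_ord i; lia.
- by move=> q; rewrite /Psi (moment_col x ha hb hab hN hr) // subrK /bC; ring.
- move=> q qx; have -> : j = i by lia.
  rewrite /Psi (moment_diag x hb hab hN hr) // lt_eqF ?mulr0 //.
  by move: qx; rewrite /component /=; lia.
- by have := ltn_ord i; lia.
- by move=> q; rewrite /Psi (moment_col x ha hb hab hN hr) // subrK /bC; ring.
- by move=> q qx; apply: IH; lia.
Qed.

(** Times m > 0 inherit the bound of time 0, since 1/(1 - a/z) has an expansion
    in non-positive powers of z only. *)
Lemma moment_eq0_below (i : 'I_N) m j p : (j <= N)%N -> p < nth 0 x i - N%:Z -> Psi i m j p = 0.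
Proof.
move=> jN px; elim: m p px => [|m IH] p px.
  have [ij|ji] := leqP i.+1 j.
    by rewrite -(subnKC ij); apply: initial_moment_below; lia.
  by apply: (@initial_moment_left i (i - j)); lia.
have [C HC] := moment_bound x ha hb hab hN hr m.+1 j (hi i).
apply: (decay_eq0 r0 (aC_lt_radius (k := m.+1) _)
  (w := fun p => Psi i m.+1 j p) (v := fun p => Psi i m j p) _ _ HC (lexx p)) => //.
- by move=> q; exact: moment_row.
- by move=> q qp; apply: IH; lia.
Qed.

Lemma det_entry0 (y : N.-tuple int) : x \in weyl_chamber -> y \in weyl_chamber ->
  \det (\matrix_(i < N, j < N) kernel_entry aC bC Psi i 0 j (nth 0 y j)) = (x == y)%:R.
Proof.
move=> hx hy.
have mono (z : N.-tuple int) : z \in weyl_chamber ->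
    forall i j : 'I_N, (i <= j)%N -> nth 0 z i <= nth 0 z j.
  move=> hz i j ij; apply: (sorted_leq_nth le_trans lexx 0 hz) => //;
    by rewrite inE size_tuple.
have bC0 j : bC j.+1 != 0.
  by rewrite real_complex_neq0 // gt_eqF // (b_gt0 hb hab).
have entryE (i j : 'I_N) : kernel_entry aC bC Psi i 0 j (nth 0 y j) =
    bC j.+1 ^ nth 0 y j * Psi i 0 j.+1 (nth 0 y j).
  by rewrite /kernel_entry big_geq // mul1r.
rewrite (@det_delta _ _ (fun i => nth 0 x i) (fun i => nth 0 y i)) //.
- congr (nat_of_bool _)%:R; apply/forallP/eqP => [e|-> //].
  apply: val_inj; apply: (@eq_from_nth _ 0); rewrite !size_tuple // => k kN.
  exact: eqP (e (Ordinal kN)).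
- exact: mono.
- exact: mono.
- move=> i; rewrite mxE entryE /Psi (moment_diag x hb hab hN hr) //.
  rewrite [component x i.+1]/(nth 0 x i) mulrA.
  case: eqP => [->|ne].
    by rewrite eqxx -expfzDr // subrr expr0z mul1r.
  by rewrite (introF eqP) ?mulr0 // => e; apply: ne.
- move=> i j ji le; rewrite mxE entryE (@initial_moment_left i (i - j.+1)) ?mulr0 //; lia.
- move=> i j ij lt; rewrite mxE entryE.
  have -> : j.+1 = (i.+1 + (j - i))%N by lia.
  by rewrite initial_moment_above // mulr0.
Qed.

Lemma det_kernel_step m (L : int) K (q : N.-tuple int) :
  (forall i : 'I_N, L < nth 0 x i - N%:Z) ->
  (forall n, (n < N)%N -> L <= nth 0 q n < L + K%:Z) -> q \in weyl_chamber ->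
  \sum_(f : {ffun 'I_N -> 'I_K} | ascending_upto N f)
     \det (\matrix_(i < N, j < N) kernel_entry aC bC Psi i m j (L + (f j)%:Z)) *
     \prod_(j < N) step_weight (aC m.+1 * bC j.+1)
        (start_height (nth 0 q) j (L + (f j)%:Z)) (nth 0 q j) =
  \det (\matrix_(i < N, j < N) kernel_entry aC bC Psi i m.+1 j (nth 0 q j)).
Proof.
move=> Lx Lq hq; apply: sum_det_step => //.
- by move=> [|j] // _; rewrite real_complex_neq0 // gt_eqF // (b_gt0 hb hab).
- by move=> [|j] // _; rewrite real_complex_neq0 // gt_eqF // (a_gt0 ha hab).
- move=> i j i1 j1; rewrite -rmorphM -(rmorph1 (real_complex R)) -rmorphB real_complex_neq0 //.
  by rewrite gt_eqF // subr_gt0; case/andP: (hab i1 j1).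
- by move=> i k j p; exact: moment_col.
- by move=> i k j p; exact: moment_row.
- by move=> i k j p jN pL; apply: moment_eq0_below => //; apply: le_lt_trans pL (Lx i).
- by move=> n nN; apply: (sorted_leq_nth le_trans lexx 0 hq); rewrite ?inE ?size_tuple // ltnW.
Qed.

End KernelDet.

(** * The transition probability *)

Lemma ascending_box_point N K L (f : {ffun 'I_N -> 'I_K}) :
  ascending_upto N f = (box_point L f \in weyl_chamber).
Proof.
apply/idP/(sortedP 0) => [/forallP H k|H].
  rewrite size_tuple => iN; have /forallP /(_ (Ordinal iN)) := H (Ordinal (ltnW iN)).
  rewrite eqxx /= (ltnW iN) -[k.+1]/(nat_of_ord (Ordinal iN)) nth_box_point.
  by rewrite -[k]/(nat_of_ord (Ordinal (ltnW iN))) nth_box_point lerD2l lez_nat.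
apply/forallP => i; apply/forallP => j; apply/implyP => /andP [/eqP ji _].
have := H i; rewrite size_tuple -ji ltn_ord !nth_box_point lerD2l lez_nat.
exact.
Qed.

Theorem theorem1 (R : realType) (a b : nat -> R)
    (ha : forall i : nat, (1 <= i)%N -> 0 <= a i <= 1)
    (hb : forall j : nat, (1 <= j)%N -> 0 <= b j <= 1)
    (hab : forall i j : nat, (1 <= i)%N -> (1 <= j)%N -> 0 < a i * b j < 1)
    (d : measure_display) (T : measurableType d) (P : probability T R)
    (omega : nat * nat -> {RV P >-> nat})
    (hgeom : forall i j : nat, (1 <= i)%N -> (1 <= j)%N ->
      is_geometric (a i * b j) (omega (i, j)))
    (hind : mutually_independent
      [set ij : nat * nat | (1 <= ij.1)%N /\ (1 <= ij.2)%N] omega)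
    (N : nat) (hN : (1 <= N)%N) (m : nat) (hm : (1 <= m)%N)
    (x y : N.-tuple int)
    (hx : x \in weyl_chamber) (hy : y \in weyl_chamber)
    (r : R) (hr : forall k : nat, (1 <= k <= N)%N -> (b k)^-1 < r) :
  (fine (P [set t : T | growth_vector x (fun i j => omega (i, j) t) m
                        = map_tuple EFin y]))%:C
  = \det (\matrix_(i < N, j < N) kernelM a b m r x y i.+1 j.+1).
Proof.
have step_weightC (c : R) s q : (step_weight c s q)%:C = step_weight c%:C s q.
  rewrite /step_weight; case: ifP => _; last by rewrite rmorph0.
  by rewrite rmorphM rmorphB rmorph1 /= fmorphXz.
pose Psi (i : 'I_N) m' j p := moment a b x r i.+1 m' j p.
pose D m' (z : N.-tuple int) := \det (\matrix_(i < N, j < N)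
  kernel_entry (fun k => (a k)%:C) (fun k => (b k)%:C) Psi i m' j (nth 0 z j)).
have -> : \det (\matrix_(i < N, j < N) kernelM a b m r x y i.+1 j.+1) = D m y.
  congr (\det _); apply/matrixP => i j; rewrite !mxE.
  by rewrite (kernelME x ha hb hab hN hr).
rewrite -/(growth_is omega x m y).
elim: m y hy {hm} => [|m IH] y hy.
  rewrite growth_is0 /D (det_entry0 ha hb hab hN hr hx hy).
  by case: eqP => _; rewrite ?probability_setT ?measure0 //= ?rmorph1 ?rmorph0.
(* The contour integrals vanish below x_i - N, because at most N factors z - 1/b_k
   raise the exponent of z; the extra 1 makes the inequality strict. *)
have [L [K LK]] := exists_box ([seq z - N%:Z - 1 | z <- x] ++ x ++ y).
have Lx n : (n < N)%N -> L <= nth 0 x n.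
  move=> nN; have /LK /andP [] // : nth 0 x n \in [seq z - N%:Z - 1 | z <- x] ++ x ++ y.
  by rewrite !mem_cat mem_nth ?size_tuple // orbT.
have Ly n : (n < N)%N -> L <= nth 0 y n < L + K%:Z.
  move=> nN; apply: LK.
  by rewrite !mem_cat [nth 0 y n \in y]mem_nth ?size_tuple // !orbT.
have LxN (i : 'I_N) : L < nth 0 x i - N%:Z.
  have /LK /andP [h _] : nth 0 x i - N%:Z - 1 \in [seq z - N%:Z - 1 | z <- x] ++ x ++ y.
    by rewrite mem_cat (map_f (fun z => z - N%:Z - 1)) // mem_nth ?size_tuple.
  by apply: le_lt_trans h _; rewrite ltrBlDr ltrDl.
have yK n : (n < N)%N -> nth 0 y n < L + K%:Z by move=> /Ly /andP [].
rewrite (growth_law_step hgeom hind m Lx yK) rmorph_sum /=.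
rewrite /D -(det_kernel_step ha hb hab hN hr m LxN Ly hy) [RHS]big_mkcond /=.
apply: eq_bigr => f _; rewrite (ascending_box_point L).
case: ifP => [hf|/negbT nf]; last first.
  by rewrite growth_is_unsorted // measure0 mul0r rmorph0.
rewrite rmorphM /= IH //; congr (_ * _).
  by congr (\det _); apply/matrixP => i j; rewrite !mxE nth_box_point.
rewrite rmorph_prod; apply: eq_bigr => j _ /=.
by rewrite step_weightC rmorphM.
Qed.
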